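(* Let $\mathscr{C}$ be an extension-closed full additive subcategory of an abelian category $\mathcal{A}$, regarded as an exact category, and assume that $\mathscr{C}$ has enough projective objects. Let $n\ge 0$ be an integer, let $M,N$ be objects of $\mathscr{C}$, and let $\delta_N\in\mathrm{Ext}^n_{\mathscr{C}}(N,\Omega^nN)$ be a syzygy sequence. For $\gamma\in\mathrm{Ext}^n_{\mathscr{C}}(M,\Omega^nN)$ let $\Psi_\gamma:\mathrm{Ext}^{n+1}_{\mathscr{C}}(N,-)\to\mathrm{Ext}^{n+1}_{\mathscr{C}}(M,-)$ be the natural transformation given, for $T\in\mathscr{C}$ and $\alpha\in\mathrm{Ext}^{n+1}_{\mathscr{C}}(N,T)$, by $\Psi_\gamma(T)(\alpha)=\alpha_1\gamma$, where $\alpha_1\in\mathrm{Ext}^1_{\mathscr{C}}(\Omega^nN,T)$ is an element for which there is a morphism of extensions $\alpha_1\delta_N\to\alpha$ with fixed ends. Then the correspondence $$\Psi:\mathrm{Ext}^n_{\mathscr{C}}(M,\Omega^nN)\longrightarrow\mathrm{Nat}\big(\mathrm{Ext}^{n+1}_{\mathscr{C}}(N,-),\mathrm{Ext}^{n+1}_{\mathscr{C}}(M,-)\big),\qquad \gamma\mapsto\Psi_\gamma,$$ induces an isomorphism of abelian groups $$\bar\Psi:\mathrm{Ext}^n_{\mathscr{C}}(M,\Omega^nN)/\mathcal{P}\longrightarrow\mathrm{Nat}\big(\mathrm{Ext}^{n+1}_{\mathscr{C}}(N,-),\mathrm{Ext}^{n+1}_{\mathscr{C}}(M,-)\big),$$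 where $\mathcal{P}$ is the subgroup consisting of those extensions arising as a push-out along a morphism $f:P\to\Omega^nN$ in $\mathscr{C}$ with $P$ projective, i.e. those $\gamma$ of the form $\gamma=f\beta$ with $\beta\in\mathrm{Ext}^n_{\mathscr{C}}(M,P)$.
   Context: Conflations in $\mathscr{C}$ are the short exact sequences of $\mathcal{A}$ with all terms in $\mathscr{C}$; they are called extensions. Projective objects are taken with respect to this exact structure. For $n\ge1$, an extension of length $n$ is an exact sequence $A\to X_{n-1}\to\cdots\to X_0\to B$ (preceded and followed by $0$) obtained by splicing $n$ conflations of $\mathscr{C}$; its left end is $A$ and its right end is $B$. $\mathrm{Ext}^n_{\mathscr{C}}(B,A)$ is the Yoneda Ext group: classes of such extensions modulo the equivalence relation generated by the existence of a morphism of extensions with fixed ends (a commutative ladder which is the identity on $A$ and on $B$), with Baer sum. By convention $\mathrm{Ext}^0_{\mathscr{C}}=\mathrm{Hom}_{\mathscr{C}}$. For $\eta\in\mathrm{Ext}^t_{\mathscr{C}}(B,A)$ and $\eta'\in\mathrm{Ext}^{t'}_{\mathscr{C}}(C,B)$, $\eta\eta'\in\mathrm{Ext}^{t+t'}_{\mathscr{C}}(C,A)$ denotes the Yoneda product (splice); if $t=0$ it is push-out, if $t'=0$ it is pull-back. A syzygy sequence $\delta_N\in\mathrm{Ext}^n_{\mathscr{C}}(N,\Omega^nN)$ is an extension $\Omega^nN\to P_{n-1}\to\cdots\to P_0\to N$ of length $n$ with all $P_i$ projective; for $n=0$, $\Omega^0N=N$ and $\delta_N=1_N$. $\mathrm{Nat}(F,G)$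 is the group of natural transformations between functors $F,G:\mathscr{C}\to\mathsf{Ab}$ (the category of abelian groups). *)

(* Defs.v *)
From Stdlib Require Import Relation_Operators.
From HB Require Import structures.
From mathcomp Require Import all_boot all_algebra.
From mathcomp Require Import boolp.

Set Implicit Arguments.
Unset Strict Implicit.
Unset Printing Implicit Defensive.

Import GRing.Theory.
Local Open Scope ring_scope.
Local Open Scope quotient_scope.

Reserved Notation "g \oc f" (at level 40, left associativity).

Record preadditive := Preadditive {
  ob :> Type;
  hom : ob -> ob -> zmodType;
  idm : forall X, hom X X;
  comp : forall X Y Z, hom Y Z -> hom X Y -> hom X Z;
  comp1m : forall X Y (f : hom X Y), comp (idm Y) f = f;
  compm1 : forall X Y (f : hom X Y), comp f (idm X) = f;
  compA : forall X Y Z W (h : hom Z W) (g : hom Y Z) (f : hom X Y),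
    comp h (comp g f) = comp (comp h g) f;
  compDl : forall X Y Z (g g' : hom Y Z) (f : hom X Y),
    comp (g + g') f = comp g f + comp g' f;
  compDr : forall X Y Z (g : hom Y Z) (f f' : hom X Y),
    comp g (f + f') = comp g f + comp g f'
}.

Arguments hom {p} : rename.
Arguments idm {p} X : rename.
Arguments comp {p X Y Z} : rename.
Notation "g \oc f" := (comp g f).

Section PreadditiveNotions.
Variable A : preadditive.

Definition monic (X Y : A) (f : hom X Y) :=
  forall W (g h : hom W X), f \oc g = f \oc h -> g = h.

Definition epic (X Y : A) (f : hom X Y) :=
  forall W (g h : hom Y W), g \oc f = h \oc f -> g = h.

Definition is_kernel (X Y K : A) (f : hom X Y) (k : hom K X) :=
  f \oc k = 0 /\
  forall W (g : hom W X), f \oc g = 0 -> exists! h : hom W K, k \oc h = g.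

Definition is_cokernel (X Y Q : A) (f : hom X Y) (q : hom Y Q) :=
  q \oc f = 0 /\
  forall W (g : hom Y W), g \oc f = 0 -> exists! h : hom Q W, h \oc q = g.

Definition short_exact (X Y Z : A) (i : hom X Y) (p : hom Y Z) :=
  is_kernel p i /\ is_cokernel i p.

End PreadditiveNotions.

Record abelian := Abelian {
  abelian_pre :> preadditive;
  zero_ob : abelian_pre;
  zero_obP : idm zero_ob = 0;
  biprod : abelian_pre -> abelian_pre -> abelian_pre;
  in1 : forall X Y, hom X (biprod X Y);
  in2 : forall X Y, hom Y (biprod X Y);
  pr1 : forall X Y, hom (biprod X Y) X;
  pr2 : forall X Y, hom (biprod X Y) Y;
  pr1in1 : forall X Y, pr1 X Y \oc in1 X Y = idm X;
  pr2in2 : forall X Y, pr2 X Y \oc in2 X Y = idm Y;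
  pr1in2 : forall X Y, pr1 X Y \oc in2 X Y = 0;
  pr2in1 : forall X Y, pr2 X Y \oc in1 X Y = 0;
  inprD : forall X Y,
    in1 X Y \oc pr1 X Y + in2 X Y \oc pr2 X Y = idm (biprod X Y);
  kernel : forall (X Y : abelian_pre) (f : hom X Y),
    {K : abelian_pre & {k : hom K X | is_kernel f k}};
  cokernel : forall (X Y : abelian_pre) (f : hom X Y),
    {Q : abelian_pre & {q : hom Y Q | is_cokernel f q}};
  monic_normal : forall (X Y : abelian_pre) (f : hom X Y), monic f ->
    exists (Z : abelian_pre) (g : hom Y Z), is_kernel g f;
  epic_normal : forall (X Y : abelian_pre) (f : hom X Y), epic f ->
    exists (Z : abelian_pre) (g : hom Z X), is_cokernel g f
}.

Arguments zero_ob {a} : rename.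
Arguments biprod {a} : rename.
Arguments in1 {a X Y} : rename.
Arguments in2 {a X Y} : rename.
Arguments pr1 {a X Y} : rename.
Arguments pr2 {a X Y} : rename.

Section CompTheory.
Variable A : preadditive.
Implicit Types X Y Z W : A.

Lemma comp0m X Y Z (f : hom X Y) : (0 : hom Y Z) \oc f = 0.
Proof. by apply: (@addrI _ (0 \oc f)); rewrite -compDl !addr0. Qed.

Lemma compm0 X Y Z (g : hom Y Z) : g \oc (0 : hom X Y) = 0.
Proof. by apply: (@addrI _ (g \oc 0)); rewrite -compDr !addr0. Qed.

Lemma compNl X Y Z (g : hom Y Z) (f : hom X Y) : (- g) \oc f = - (g \oc f).
Proof. by apply: (@addrI _ (g \oc f)); rewrite -compDl !subrr comp0m. Qed.

Lemma compNr X Y Z (g : hom Y Z) (f : hom X Y) : g \oc (- f) = - (g \oc f).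
Proof. by apply: (@addrI _ (g \oc f)); rewrite -compDr !subrr compm0. Qed.

Lemma kernel_monic X Y K (f : hom X Y) (k : hom K X) : is_kernel f k -> monic k.
Proof.
case=> fk0 univ W g h kgh.
have fkg0 : f \oc (k \oc g) = 0 by rewrite compA fk0 comp0m.
have [u [_ uniq_u]] := univ W _ fkg0.
by rewrite -(uniq_u g) // -(uniq_u h).
Qed.

Lemma cokernel_epic X Y Q (f : hom X Y) (q : hom Y Q) :
  is_cokernel f q -> epic q.
Proof.
case=> qf0 univ W g h gqh.
have gqf0 : g \oc q \oc f = 0 by rewrite -compA qf0 compm0.
have [u [_ uniq_u]] := univ W _ gqf0.
by rewrite -(uniq_u g) // -(uniq_u h).
Qed.

Lemma kernel_ker_coker X Y Z Q (i : hom X Y) (g : hom Y Z) (q : hom Y Q) :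
  is_kernel g i -> is_cokernel i q -> is_kernel q i.
Proof.
move=> kerig cokq; have mono_i := kernel_monic kerig.
case: kerig cokq => gi0 univ [qi0 couniv]; split=> // W h qh0.
have [u [uq _]] := couniv _ _ gi0.
have [|v [iv _]] := univ _ h; first by rewrite -uq -compA qh0 compm0.
by exists v; split=> // v' iv'; apply: mono_i; rewrite iv iv'.
Qed.

Lemma cokernel_coker_ker X Y Z K (p : hom Y Z) (g : hom X Y) (k : hom K Y) :
  is_cokernel g p -> is_kernel p k -> is_cokernel k p.
Proof.
move=> cokp kerk; have epi_p := cokernel_epic cokp.
case: cokp kerk => pg0 couniv [pk0 univ]; split=> // W h hk0.
have [u [ku _]] := univ _ _ pg0.
have [|v [vp _]] := couniv _ h; first by rewrite -ku compA hk0 comp0m.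
by exists v; split=> // v' vp'; apply: epi_p; rewrite vp vp'.
Qed.

End CompTheory.

Section BiproductTheory.
Variable A : abelian.
Implicit Types X Y Z W : A.

Definition row2 X Y Z (f : hom X Z) (g : hom Y Z) : hom (biprod X Y) Z :=
  f \oc pr1 + g \oc pr2.

Definition col2 X Y Z (f : hom Z X) (g : hom Z Y) : hom Z (biprod X Y) :=
  in1 \oc f + in2 \oc g.

Definition diag2 X Y X' Y' (f : hom X X') (g : hom Y Y') :
  hom (biprod X Y) (biprod X' Y') := col2 (f \oc pr1) (g \oc pr2).

Lemma row2_in1 X Y Z (f : hom X Z) (g : hom Y Z) : row2 f g \oc in1 = f.
Proof. by rewrite /row2 compDl -!compA pr1in1 pr2in1 compm1 compm0 addr0. Qed.

Lemma row2_in2 X Y Z (f : hom X Z) (g : hom Y Z) : row2 f g \oc in2 = g.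
Proof. by rewrite /row2 compDl -!compA pr1in2 pr2in2 compm1 compm0 add0r. Qed.

Lemma pr1_col2 X Y Z (f : hom Z X) (g : hom Z Y) : pr1 \oc col2 f g = f.
Proof. by rewrite /col2 compDr !compA pr1in1 pr1in2 comp1m comp0m addr0. Qed.

Lemma pr2_col2 X Y Z (f : hom Z X) (g : hom Z Y) : pr2 \oc col2 f g = g.
Proof. by rewrite /col2 compDr !compA pr2in1 pr2in2 comp1m comp0m add0r. Qed.

Lemma bip_out X Y Z (f g : hom (biprod X Y) Z) :
  f \oc in1 = g \oc in1 -> f \oc in2 = g \oc in2 -> f = g.
Proof.
move=> e1 e2; rewrite -(compm1 f) -(compm1 g) -inprD !compDr !compA.
by rewrite e1 e2.
Qed.

Lemma bip_in X Y Z (f g : hom Z (biprod X Y)) :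
  pr1 \oc f = pr1 \oc g -> pr2 \oc f = pr2 \oc g -> f = g.
Proof.
move=> e1 e2; rewrite -(comp1m f) -(comp1m g) -inprD !compDl -!compA.
by rewrite e1 e2.
Qed.

Lemma comp_row2 X Y Z W (h : hom Z W) (f : hom X Z) (g : hom Y Z) :
  h \oc row2 f g = row2 (h \oc f) (h \oc g).
Proof. by rewrite /row2 compDr !compA. Qed.

Lemma col2_comp X Y Z W (f : hom Z X) (g : hom Z Y) (h : hom W Z) :
  col2 f g \oc h = col2 (f \oc h) (g \oc h).
Proof. by rewrite /col2 compDl !compA. Qed.

Lemma row2_col2 X Y Z W (f : hom X Z) (g : hom Y Z) (h : hom W X)
  (k : hom W Y) : row2 f g \oc col2 h k = f \oc h + g \oc k.
Proof. by rewrite /col2 compDr !compA row2_in1 row2_in2. Qed.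

Lemma diag2_col2 X Y X' Y' Z (f : hom X X') (g : hom Y Y') (h : hom Z X)
  (k : hom Z Y) : diag2 f g \oc col2 h k = col2 (f \oc h) (g \oc k).
Proof. by rewrite /diag2 col2_comp -!compA pr1_col2 pr2_col2. Qed.

Lemma row2_diag2 X Y X' Y' Z (f : hom X X') (g : hom Y Y') (h : hom X' Z)
  (k : hom Y' Z) : row2 h k \oc diag2 f g = row2 (h \oc f) (k \oc g).
Proof. by rewrite /diag2 row2_col2 /row2 !compA. Qed.

Lemma diag2_comp X Y X' Y' X'' Y'' (f : hom X X') (g : hom Y Y')
  (h : hom X' X'') (k : hom Y' Y'') :
  diag2 h k \oc diag2 f g = diag2 (h \oc f) (k \oc g).
Proof. by rewrite {2}/diag2 diag2_col2 /diag2 !compA. Qed.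

Lemma diag2_id X Y : diag2 (idm X) (idm Y) = idm (biprod X Y).
Proof. by rewrite /diag2 /col2 !comp1m inprD. Qed.

Lemma diag2_0 X Y X' Y' : diag2 0 0 = 0 :> hom (biprod X Y) (biprod X' Y').
Proof. by rewrite /diag2 /col2 !comp0m !compm0 addr0. Qed.

Lemma monic_of0 X Y (f : hom X Y) :
  (forall W (g : hom W X), f \oc g = 0 -> g = 0) -> monic f.
Proof.
move=> f0 W g h fgh; apply/eqP; rewrite -subr_eq0; apply/eqP/f0.
by rewrite compDr compNr fgh subrr.
Qed.

Lemma epic_of0 X Y (f : hom X Y) :
  (forall W (g : hom Y W), g \oc f = 0 -> g = 0) -> epic f.
Proof.
move=> f0 W g h fgh; apply/eqP; rewrite -subr_eq0; apply/eqP/f0.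
by rewrite compDl compNl fgh subrr.
Qed.

Lemma monic_short_exact X Y Q (i : hom X Y) (q : hom Y Q) :
  monic i -> is_cokernel i q -> short_exact i q.
Proof.
move=> /monic_normal[Z [g kerg]] cokq; split=> //.
exact: kernel_ker_coker kerg cokq.
Qed.

Lemma epic_short_exact K Y Z (k : hom K Y) (p : hom Y Z) :
  epic p -> is_kernel p k -> short_exact k p.
Proof.
move=> /epic_normal[X [g cokg]] kerk; split=> //.
exact: cokernel_coker_ker cokg kerk.
Qed.

Lemma zero_obl X (f : hom zero_ob X) : f = 0.
Proof. by rewrite -(compm1 f) zero_obP compm0. Qed.

Lemma zero_obr X (f : hom X zero_ob) : f = 0.
Proof. by rewrite -(comp1m f) zero_obP comp0m. Qed.

Section Pushout.
Variables (X Y Z X' : A) (i : hom X Y) (p : hom Y Z) (f : hom X X').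
Hypothesis ip : short_exact i p.

Definition pushout : A := projT1 (cokernel (col2 i (- f))).

Definition pushout_proj : hom (biprod Y X') pushout :=
  sval (projT2 (cokernel (col2 i (- f)))).

Lemma pushout_projP : is_cokernel (col2 i (- f)) pushout_proj.
Proof. exact: svalP (projT2 (cokernel (col2 i (- f)))). Qed.

Definition pushout_in1 : hom Y pushout := pushout_proj \oc in1.
Definition pushout_in2 : hom X' pushout := pushout_proj \oc in2.

Lemma pushout_projE : pushout_proj = row2 pushout_in1 pushout_in2.
Proof. by rewrite -comp_row2 /row2 inprD compm1. Qed.

Lemma pushoutC : pushout_in1 \oc i = pushout_in2 \oc f.
Proof.
have [+ _] := pushout_projP; rewrite pushout_projE row2_col2 compNr.
by move/eqP; rewrite subr_eq0 => /eqP.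
Qed.

Lemma pushout_univ W (u : hom Y W) (v : hom X' W) : u \oc i = v \oc f ->
  exists2 h : hom pushout W, h \oc pushout_in1 = u & h \oc pushout_in2 = v.
Proof.
move=> uv; have [_ univ] := pushout_projP.
have [|h [hE _]] := univ W (row2 u v).
  by rewrite row2_col2 compNr uv subrr.
by exists h; rewrite compA hE (row2_in1, row2_in2).
Qed.

Lemma pushout_eq W (u v : hom pushout W) :
  u \oc pushout_in1 = v \oc pushout_in1 ->
  u \oc pushout_in2 = v \oc pushout_in2 -> u = v.
Proof.
move=> e1 e2; apply: (cokernel_epic pushout_projP).
by rewrite pushout_projE !comp_row2 e1 e2.
Qed.

Lemma pushout_def_subproof :
  exists h : hom pushout Z, h \oc pushout_in1 = p /\ h \oc pushout_in2 = 0.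
Proof.
have [|h h1 h2] := @pushout_univ Z p 0; last by exists h.
by rewrite comp0m; case: ip => _ [].
Qed.

Definition pushout_def : hom pushout Z := sval (cid pushout_def_subproof).

Lemma pushout_def1 : pushout_def \oc pushout_in1 = p.
Proof. by have [] := svalP (cid pushout_def_subproof). Qed.

Lemma pushout_def2 : pushout_def \oc pushout_in2 = 0.
Proof. by have [] := svalP (cid pushout_def_subproof). Qed.

Lemma pushout_exact : short_exact pushout_in2 pushout_def.
Proof.
have [keri [pi0 couniv]] := ip; have mono_i := kernel_monic keri.
have mono_j : monic (col2 i (- f)).
  apply: monic_of0 => W g jg0; apply: mono_i; rewrite compm0.
  by rewrite -(pr1_col2 (i \oc g) (- f \oc g)) -col2_comp jg0 compm0.
apply: monic_short_exact.
  apply: monic_of0 => W g.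
  have [[_ univ] _] := monic_short_exact mono_j pushout_projP.
  rewrite /pushout_in2 -compA => /univ[h [jh _]].
  have h0 : h = 0.
    apply: mono_i; rewrite compm0 -(pr1_col2 (i \oc h) (- f \oc h)) -col2_comp.
    by rewrite jh compA pr1in2 comp0m.
  by rewrite -(comp1m g) -(pr2in2 Y X') -compA -jh h0 !compm0.
split=> [|W g gi0]; first exact: pushout_def2.
have [|h [hp uniq_h]] := couniv W (g \oc pushout_in1).
  by rewrite -compA pushoutC compA gi0 comp0m.
exists h; split=> [|h' h'E].
  by apply: pushout_eq; rewrite -compA ?pushout_def1 // pushout_def2 compm0.
by apply: uniq_h; rewrite -h'E -compA pushout_def1.
Qed.

End Pushout.

Section Pullback.
Variables (X Y Z Z' : A) (i : hom X Y) (p : hom Y Z) (g : hom Z' Z).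
Hypothesis ip : short_exact i p.

Definition pullback : A := projT1 (kernel (row2 p (- g))).

Definition pullback_inc : hom pullback (biprod Y Z') :=
  sval (projT2 (kernel (row2 p (- g)))).

Lemma pullback_incP : is_kernel (row2 p (- g)) pullback_inc.
Proof. exact: svalP (projT2 (kernel (row2 p (- g)))). Qed.

Definition pullback_pr1 : hom pullback Y := pr1 \oc pullback_inc.
Definition pullback_pr2 : hom pullback Z' := pr2 \oc pullback_inc.

Lemma pullback_incE : pullback_inc = col2 pullback_pr1 pullback_pr2.
Proof. by rewrite -col2_comp /col2 inprD comp1m. Qed.

Lemma pullbackC : p \oc pullback_pr1 = g \oc pullback_pr2.
Proof.
have [+ _] := pullback_incP; rewrite pullback_incE row2_col2 compNl.
by move/eqP; rewrite subr_eq0 => /eqP.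
Qed.

Lemma pullback_univ W (u : hom W Y) (v : hom W Z') : p \oc u = g \oc v ->
  exists2 h : hom W pullback, pullback_pr1 \oc h = u & pullback_pr2 \oc h = v.
Proof.
move=> uv; have [_ univ] := pullback_incP.
have [|h [hE _]] := univ W (col2 u v).
  by rewrite row2_col2 compNl uv subrr.
by exists h; rewrite -compA hE (pr1_col2, pr2_col2).
Qed.

Lemma pullback_eq W (u v : hom W pullback) :
  pullback_pr1 \oc u = pullback_pr1 \oc v ->
  pullback_pr2 \oc u = pullback_pr2 \oc v -> u = v.
Proof.
move=> e1 e2; apply: (kernel_monic pullback_incP).
by rewrite pullback_incE !col2_comp e1 e2.
Qed.

Lemma pullback_inf_subproof :
  exists h : hom X pullback, pullback_pr1 \oc h = i /\ pullback_pr2 \oc h = 0.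
Proof.
have [|h h1 h2] := @pullback_univ X i 0; last by exists h.
by rewrite compm0; case: ip => [[]].
Qed.

Definition pullback_inf : hom X pullback := sval (cid pullback_inf_subproof).

Lemma pullback_inf1 : pullback_pr1 \oc pullback_inf = i.
Proof. by have [] := svalP (cid pullback_inf_subproof). Qed.

Lemma pullback_inf2 : pullback_pr2 \oc pullback_inf = 0.
Proof. by have [] := svalP (cid pullback_inf_subproof). Qed.

Lemma pullback_exact : short_exact pullback_inf pullback_pr2.
Proof.
have [[pi0 univ] cokp] := ip; have epi_p := cokernel_epic cokp.
have epi_j : epic (row2 p (- g)).
  apply: epic_of0 => W h hj0; apply: epi_p; rewrite comp0m.
  by rewrite -(row2_in1 (h \oc p) (h \oc (- g))) -comp_row2 hj0 comp0m.
apply: epic_short_exact.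
  apply: epic_of0 => W h.
  have [_ [_ couniv]] := epic_short_exact epi_j pullback_incP.
  rewrite /pullback_pr2 compA => /couniv[u [uj _]].
  have u0 : u = 0.
    apply: epi_p; rewrite comp0m -(row2_in1 (u \oc p) (u \oc (- g))) -comp_row2.
    by rewrite uj -compA pr2in1 compm0.
  by rewrite -(compm1 h) -(pr2in2 Y Z') compA -uj u0 !comp0m.
split=> [|W h ph0]; first exact: pullback_inf2.
have [|u [iu uniq_u]] := univ W (pullback_pr1 \oc h).
  by rewrite compA pullbackC -compA ph0 compm0.
exists u; split=> [|u' u'E].
  by apply: pullback_eq; rewrite compA ?pullback_inf1 // pullback_inf2 comp0m.
by apply: uniq_u; rewrite -u'E compA pullback_inf1.
Qed.

End Pullback.

Lemma diag2_exact X Y Z X' Y' Z' (i : hom X Y) (p : hom Y Z)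
  (i' : hom X' Y') (p' : hom Y' Z') :
  short_exact i p -> short_exact i' p' -> short_exact (diag2 i i') (diag2 p p').
Proof.
move=> [keri cokp] [keri' cokp'].
have [[mi mi'] [ep ep']] := (conj (conj (kernel_monic keri) (kernel_monic keri'))
  (conj (cokernel_epic cokp) (cokernel_epic cokp'))).
case: keri cokp keri' cokp' => [pi0 univ] [_ couniv] [pi0' univ'] [_ couniv'].
have dd0 : diag2 p p' \oc diag2 i i' = 0 by rewrite diag2_comp pi0 pi0' diag2_0.
have prD (V V' W W' T : A) (a : hom V W) (b : hom V' W')
    (u : hom T (biprod V V')) :
    pr1 \oc (diag2 a b \oc u) = a \oc (pr1 \oc u)
    /\ pr2 \oc (diag2 a b \oc u) = b \oc (pr2 \oc u).
  by rewrite !compA /diag2 pr1_col2 pr2_col2.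
have inD (V V' W W' T : A) (a : hom V W) (b : hom V' W')
    (u : hom (biprod W W') T) :
    u \oc diag2 a b \oc in1 = u \oc in1 \oc a
    /\ u \oc diag2 a b \oc in2 = u \oc in2 \oc b.
  rewrite -!compA /diag2 !col2_comp -!compA pr1in1 pr2in2 pr1in2 pr2in1.
  by rewrite !compm1 !compm0 /col2 !compm0 addr0 add0r.
split; split=> // W g g0.
- have [e1 e2] := prD _ _ _ _ _ p p' g; rewrite g0 !compm0 in e1 e2.
  have [u [iu _]] := univ _ _ (esym e1); have [v [iv _]] := univ' _ _ (esym e2).
  exists (col2 u v); split=> [|h hE].
    by rewrite diag2_col2 iu iv -col2_comp /col2 inprD comp1m.
  have [] := prD _ _ _ _ _ i i' h; rewrite hE -iu -iv => e3 e4.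
  by apply: bip_in; rewrite ?pr1_col2 ?pr2_col2; [exact: mi|exact: mi'].
- have [e1 e2] := inD _ _ _ _ _ i i' g; rewrite g0 !comp0m in e1 e2.
  have [u [up _]] := couniv _ _ (esym e1).
  have [v [vp _]] := couniv' _ _ (esym e2).
  exists (row2 u v); split=> [|h hE].
    by rewrite row2_diag2 up vp -comp_row2 /row2 inprD compm1.
  have [] := inD _ _ _ _ _ p p' h; rewrite hE -up -vp => e3 e4.
  by apply: bip_out; rewrite ?row2_in1 ?row2_in2; [exact: ep|exact: ep'].
Qed.

Lemma split_exact X Y : short_exact (@in1 _ X Y) pr2.
Proof.
split; split=> [|W g g0]; rewrite ?pr2in1 //.
  exists (pr1 \oc g); split=> [|h <-]; last by rewrite compA pr1in1 comp1m.
  by apply: bip_in; rewrite compA ?pr1in1 ?comp1m // pr2in1 comp0m g0.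
exists (g \oc in2); split=> [|h <-]; last by rewrite -compA pr2in2 compm1.
by apply: bip_out; rewrite -compA ?pr2in2 ?compm1 // pr2in1 compm0 g0.
Qed.

Lemma id_exact X : short_exact (idm X) (0 : hom X zero_ob).
Proof.
split; split=> [|W g g0]; rewrite ?comp0m //.
  by exists g; split=> [|h <-]; rewrite comp1m.
exists 0; split=> [|h _]; last by rewrite [RHS]zero_obl.
by rewrite comp0m -[RHS]compm1.
Qed.

End BiproductTheory.

Arguments row2 {A X Y Z}.
Arguments col2 {A X Y Z}.
Arguments diag2 {A X Y X' Y'}.

(* Full subcategories are given by a predicate on objects; closure under
   extensions (together with mem0) entails closure under isomorphism. *)
Record subcat (A : abelian) := Subcat {
  mem : A -> Prop;
  mem0 : mem zero_ob;
  mem_biprod : forall X Y, mem X -> mem Y -> mem (biprod X Y);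
  mem_ext : forall (X Y Z : A) (i : hom X Y) (p : hom Y Z),
    short_exact i p -> mem X -> mem Z -> mem Y
}.

Record obj (A : abelian) (C : subcat A) := Obj {
  obj_val :> A;
  obj_mem : mem C obj_val
}.

Section ExactStructure.
Variables (A : abelian) (C : subcat A).
Implicit Types X Y Z T : obj C.

Definition obj0 : obj C := Obj (mem0 C).
Definition objD X Y : obj C := Obj (mem_biprod (obj_mem X) (obj_mem Y)).

Record conflation X Z := Conflation {
  cmid : obj C;
  cinf : hom X cmid;
  cdef : hom cmid Z;
  cexact : short_exact cinf cdef
}.

Definition projective (P : obj C) :=
  forall X Z (c : conflation X Z) (f : hom P Z),
    exists g : hom P (cmid c), cdef c \oc g = f.

Definition enough_projectives :=
  forall Z, exists X, exists c : conflation X Z, projective (cmid c).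

Definition conf_push X X' Z (f : hom X X') (c : conflation X Z) :
    conflation X' Z :=
  let e := pushout_exact f (cexact c) in
  @Conflation X' Z (Obj (mem_ext e (obj_mem X') (obj_mem Z))) _ _ e.

Definition conf_pull X Z Z' (c : conflation X Z) (g : hom Z' Z) :
    conflation X Z' :=
  let e := pullback_exact g (cexact c) in
  @Conflation X Z' (Obj (mem_ext e (obj_mem X) (obj_mem Z'))) _ _ e.

Definition conf_sum X Z X' Z' (c : conflation X Z) (c' : conflation X' Z') :
    conflation (objD X X') (objD Z Z') :=
  @Conflation (objD X X') (objD Z Z') (objD (cmid c) (cmid c')) _ _
    (diag2_exact (cexact c) (cexact c')).

Definition conf_split X Z : conflation X Z :=
  @Conflation X Z (objD X Z) _ _ (split_exact X Z).

Definition conf_id X : conflation X obj0 := @Conflation X obj0 X _ _ (id_exact X).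

Definition conf_mor X Z X' Z' (f : hom X X') (g : hom Z Z')
    (c : conflation X Z) (c' : conflation X' Z') : Prop :=
  exists x : hom (cmid c) (cmid c'),
    x \oc cinf c = cinf c' \oc f /\ cdef c' \oc x = g \oc cdef c.

(* [yext m X Z]: extensions of length m.+1 with left end X and right end Z,
   presented by the m.+1 conflations being spliced, the leftmost one first. *)
Fixpoint yext (m : nat) X Z : Type :=
  if m is m'.+1 then {K : obj C & (conflation X K * yext m' K Z)%type}
  else conflation X Z.

Definition ycons m X K Z (c : conflation X K) (e : yext m K Z) :
  yext m.+1 X Z := existT _ K (c, e).

(* The maps between the splicing objects are induced by, and determined by, the
   rungs of the ladder. *)
Fixpoint ladder (m : nat) X Z X' Z' (f : hom X X') (g : hom Z Z') :
    yext m X Z -> yext m X' Z' -> Prop :=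
  match m return yext m X Z -> yext m X' Z' -> Prop with
  | 0 => fun e e' => conf_mor f g e e'
  | m'.+1 => fun e e' =>
      exists k : hom (projT1 e) (projT1 e'),
        conf_mor f k (projT2 e).1 (projT2 e').1
        /\ ladder k g (projT2 e).2 (projT2 e').2
  end.

Definition ladder_fixed m X Z (e e' : yext m X Z) :=
  ladder (idm X) (idm Z) e e'.

Definition ypush (m : nat) X X' Z (f : hom X X') : yext m X Z -> yext m X' Z :=
  match m return yext m X Z -> yext m X' Z with
  | 0 => fun e => conf_push f e
  | m'.+1 => fun e => ycons (conf_push f (projT2 e).1) (projT2 e).2
  end.

Fixpoint ypull (m : nat) X Z Z' (g : hom Z' Z) : yext m X Z -> yext m X Z' :=
  match m return yext m X Z -> yext m X Z' with
  | 0 => fun e => conf_pull e g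
  | m'.+1 => fun e => ycons (projT2 e).1 (ypull g (projT2 e).2)
  end.

Fixpoint ysum (m : nat) X Z X' Z' :
    yext m X Z -> yext m X' Z' -> yext m (objD X X') (objD Z Z') :=
  match m return yext m X Z -> yext m X' Z' ->
    yext m (objD X X') (objD Z Z') with
  | 0 => fun e e' => conf_sum e e'
  | m'.+1 => fun e e' =>
      ycons (conf_sum (projT2 e).1 (projT2 e').1)
        (ysum (projT2 e).2 (projT2 e').2)
  end.

(* X = X -> 0 -> ... -> 0 -> Z = Z, or X -> X (+) Z -> Z when m = 0. *)
Fixpoint ysplit (m : nat) X Z : yext m X Z :=
  if m is m'.+1 then ycons (conf_id X) (ysplit m' obj0 Z) else conf_split X Z.

Definition ybaer m X Z (e e' : yext m X Z) : yext m X Z :=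
  ypush (row2 (idm X) (idm X) : hom (objD X X) X)
    (ypull (col2 (idm Z) (idm Z) : hom Z (objD Z Z)) (ysum e e')).

Definition yequiv m X Z (e e' : yext m X Z) : bool :=
  `[< clos_refl_sym_trans _ (@ladder_fixed m X Z) e e' >].

Lemma yequivP m X Z (e e' : yext m X Z) :
  reflect (clos_refl_sym_trans _ (@ladder_fixed m X Z) e e') (yequiv e e').
Proof. exact: asboolP. Qed.

Lemma ladder_equiv m X Z (e e' : yext m X Z) : ladder_fixed e e' -> yequiv e e'.
Proof. by move=> l; apply/yequivP/rst_step. Qed.

Lemma yequiv_is_equiv m X Z : equiv_class_of (@yequiv m X Z).
Proof.
split=> [e|e e'|e e' e'']; first exact/yequivP/rst_refl.
  by apply/yequivP/yequivP => ?; apply: rst_sym.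
by move=> /yequivP l /yequivP l'; apply/yequivP; apply: rst_trans l l'.
Qed.

Lemma yequiv_refl m X Z (e : yext m X Z) : yequiv e e.
Proof. by case: (yequiv_is_equiv m X Z). Qed.

Lemma yequiv_sym m X Z (e e' : yext m X Z) : yequiv e e' -> yequiv e' e.
Proof. by case: (yequiv_is_equiv m X Z) => _ s _; rewrite s. Qed.

Lemma yequiv_trans m X Z (e e' e'' : yext m X Z) :
  yequiv e e' -> yequiv e' e'' -> yequiv e e''.
Proof. by case: (yequiv_is_equiv m X Z) => _ _; apply. Qed.

Lemma yequiv_map m X Z m' X' Z' (F : yext m X Z -> yext m' X' Z') :
  (forall e e', ladder_fixed e e' -> ladder_fixed (F e) (F e')) ->
  forall e e', yequiv e e' -> yequiv (F e) (F e').
Proof.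
move=> FP e e' /yequivP; elim=> [?? /FP /ladder_equiv //|?|???|?? e'' _ + _].
- exact: yequiv_refl.
- exact: yequiv_sym.
- exact: yequiv_trans.
Qed.

Lemma conf_mor_comp X Z X' Z' X'' Z'' (f : hom X X') (g : hom Z Z')
  (f' : hom X' X'') (g' : hom Z' Z'') c c' c'' :
  conf_mor f g c c' -> conf_mor f' g' c' c'' ->
  conf_mor (f' \oc f) (g' \oc g) c c''.
Proof.
move=> [x [xi px]] [x' [xi' px']]; exists (x' \oc x); split.
  by rewrite -compA xi compA xi' compA.
by rewrite compA px' -compA px compA.
Qed.

Lemma conf_mor_id X Z (c : conflation X Z) : conf_mor (idm X) (idm Z) c c.
Proof. by exists (idm _); rewrite !comp1m !compm1. Qed.

Lemma conf_mor_sum X1 Z1 X1' Z1' X2 Z2 X2' Z2' (f1 : hom X1 X1')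
  (g1 : hom Z1 Z1') (f2 : hom X2 X2') (g2 : hom Z2 Z2') c1 c1' c2 c2' :
  conf_mor f1 g1 c1 c1' -> conf_mor f2 g2 c2 c2' ->
  @conf_mor (objD X1 X2) (objD Z1 Z2) (objD X1' X2') (objD Z1' Z2')
    (diag2 f1 f2) (diag2 g1 g2) (conf_sum c1 c2) (conf_sum c1' c2').
Proof.
move=> [x [xi px]] [x' [xi' px']]; exists (diag2 x x' : hom (objD _ _) (objD _ _)).
by rewrite /= !diag2_comp xi px xi' px'.
Qed.

Lemma conf_push_mor X X' Z (f : hom X X') (c : conflation X Z) :
  conf_mor f (idm Z) c (conf_push f c).
Proof.
exists (pushout_in1 (cinf c) f); rewrite /= pushoutC; split=> //.
by rewrite comp1m pushout_def1.
Qed.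

Lemma conf_push_univ X X' Z X'' Z'' (f : hom X X') (h : hom X' X'')
    (g : hom Z Z'') (c : conflation X Z) (c'' : conflation X'' Z'') :
  conf_mor (h \oc f) g c c'' -> conf_mor h g (conf_push f c) c''.
Proof.
move=> [x [xi px]].
have [|u u1 u2] := @pushout_univ _ _ _ _ (cinf c) f _ x (cinf c'' \oc h).
  by rewrite xi compA.
exists u; split=> //=; have [[pi0 _] _] := cexact c''.
by apply: pushout_eq; rewrite -!compA ?u1 ?u2 ?pushout_def1 // pushout_def2
  compA pi0 comp0m compm0.
Qed.

Lemma conf_pull_mor X Z Z' (c : conflation X Z) (g : hom Z' Z) :
  conf_mor (idm X) g (conf_pull c g) c.
Proof.
exists (pullback_pr1 (cdef c) g); rewrite /= pullbackC; split=> //.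
by rewrite compm1 pullback_inf1.
Qed.

Lemma conf_pull_univ X Z Z' X'' Z'' (g : hom Z' Z) (h : hom Z'' Z')
    (f : hom X'' X) (c : conflation X Z) (c'' : conflation X'' Z'') :
  conf_mor f (g \oc h) c'' c -> conf_mor f h c'' (conf_pull c g).
Proof.
move=> [x [xi px]].
have [|u u1 u2] := @pullback_univ _ _ _ _ (cdef c) g _ x (h \oc cdef c'').
  by rewrite px compA.
exists u; split=> //=; have [_ [pi0 _]] := cexact c''.
by apply: pullback_eq; rewrite !compA ?u1 ?u2 ?pullback_inf1 // pullback_inf2
  -compA pi0 comp0m compm0.
Qed.

Lemma ladder_comp m X Z X' Z' X'' Z'' (f : hom X X') (g : hom Z Z')
  (f' : hom X' X'') (g' : hom Z' Z'') (e : yext m X Z) e' e'' :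
  ladder f g e e' -> ladder f' g' e' e'' ->
  ladder (f' \oc f) (g' \oc g) e e''.
Proof.
elim: m X X' X'' f f' e e' e'' => /= [|m IH] X X' X'' f f' e e' e''.
  exact: conf_mor_comp.
move=> [k [ck lk]] [k' [ck' lk']]; exists (k' \oc k).
by split; [apply: conf_mor_comp ck ck' | apply: IH lk lk'].
Qed.

Lemma ladder_id m X Z (e : yext m X Z) : ladder (idm X) (idm Z) e e.
Proof.
elim: m X e => /= [|m IH] X e; first exact: conf_mor_id.
by exists (idm _); split; [apply: conf_mor_id | apply: IH].
Qed.

Lemma ladder_sum m X1 Z1 X1' Z1' X2 Z2 X2' Z2' (f1 : hom X1 X1')
  (g1 : hom Z1 Z1') (f2 : hom X2 X2') (g2 : hom Z2 Z2')
  (e1 : yext m X1 Z1) e1' (e2 : yext m X2 Z2) e2' :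
  ladder f1 g1 e1 e1' -> ladder f2 g2 e2 e2' ->
  @ladder m (objD X1 X2) (objD Z1 Z2) (objD X1' X2') (objD Z1' Z2')
    (diag2 f1 f2) (diag2 g1 g2) (ysum e1 e2) (ysum e1' e2').
Proof.
elim: m X1 X1' X2 X2' f1 f2 e1 e1' e2 e2'
  => /= [|m IH] X1 X1' X2 X2' f1 f2 e1 e1' e2 e2'; first exact: conf_mor_sum.
move=> [k [ck lk]] [k' [ck' lk']].
exists (diag2 k k' : hom (objD _ _) (objD _ _)).
by split; [apply: conf_mor_sum | apply: IH].
Qed.

Lemma ypush_ladder m X X' Z (f : hom X X') (e : yext m X Z) :
  ladder f (idm Z) e (ypush f e).
Proof.
case: m e => /= [|m] e; first exact: conf_push_mor.
by exists (idm _); split; [apply: conf_push_mor | apply: ladder_id].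
Qed.

Lemma ypush_univ m X X' Z X'' Z'' (f : hom X X') (h : hom X' X'')
    (g : hom Z Z'') (e : yext m X Z) (e'' : yext m X'' Z'') :
  ladder (h \oc f) g e e'' -> ladder h g (ypush f e) e''.
Proof.
case: m e e'' => /= [|m] e e''; first exact: conf_push_univ.
by move=> [k [ck lk]]; exists k; split=> //; apply: conf_push_univ.
Qed.

Lemma ypull_ladder m X Z Z' (g : hom Z' Z) (e : yext m X Z) :
  ladder (idm X) g (ypull g e) e.
Proof.
elim: m X e => /= [|m IH] X e; first exact: conf_pull_mor.
by exists (idm _); split; [apply: conf_mor_id | apply: IH].
Qed.

Lemma ypull_univ m X Z Z' X'' Z'' (g : hom Z' Z) (h : hom Z'' Z')
    (f : hom X'' X) (e : yext m X Z) (e'' : yext m X'' Z'') :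
  ladder f (g \oc h) e'' e -> ladder f h e'' (ypull g e).
Proof.
elim: m X X'' f e e'' => /= [|m IH] X X'' f e e''; first exact: conf_pull_univ.
by move=> [k [ck lk]]; exists k; split=> //; apply: IH.
Qed.

Lemma ladder_push_pull m X Z X' Z' (f : hom X X') (g : hom Z Z')
    (e : yext m X Z) (e' : yext m X' Z') :
  ladder f g e e' -> ladder_fixed (ypush f e) (ypull g e').
Proof. by move=> l; apply/ypull_univ/ypush_univ; rewrite comp1m compm1. Qed.

Lemma ypush_mono m X X' Z (f : hom X X') (e e' : yext m X Z) :
  ladder_fixed e e' -> ladder_fixed (ypush f e) (ypush f e').
Proof.
move=> l; apply: ypush_univ; rewrite comp1m.
by have := ladder_comp l (ypush_ladder f e'); rewrite compm1 comp1m.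
Qed.

Lemma ypull_mono m X Z Z' (g : hom Z' Z) (e e' : yext m X Z) :
  ladder_fixed e e' -> ladder_fixed (ypull g e) (ypull g e').
Proof.
move=> l; apply: ypull_univ; rewrite compm1.
by have := ladder_comp (ypull_ladder g e) l; rewrite compm1 comp1m.
Qed.

Lemma ycons_monol m X K Z (e : yext m K Z) (c c' : conflation X K) :
  conf_mor (idm X) (idm K) c c' -> ladder_fixed (ycons c e) (ycons c' e).
Proof. by move=> l; exists (idm _); split=> //; apply: ladder_id. Qed.

Lemma ycons_monor m X K Z (c : conflation X K) (e e' : yext m K Z) :
  ladder_fixed e e' -> ladder_fixed (ycons c e) (ycons c e').
Proof. by move=> l; exists (idm _); split=> //; apply: conf_mor_id. Qed.

Lemma ypush_equiv m X X' Z (f : hom X X') (e e' : yext m X Z) :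
  yequiv e e' -> yequiv (ypush f e) (ypush f e').
Proof. exact/yequiv_map/ypush_mono. Qed.

Lemma ypull_equiv m X Z Z' (g : hom Z' Z) (e e' : yext m X Z) :
  yequiv e e' -> yequiv (ypull g e) (ypull g e').
Proof. exact/yequiv_map/ypull_mono. Qed.

Lemma ysum_equiv m X Z X' Z' (e1 e1' : yext m X Z) (e2 e2' : yext m X' Z') :
  yequiv e1 e1' -> yequiv e2 e2' -> yequiv (ysum e1 e2) (ysum e1' e2').
Proof.
move=> l1 l2; apply: (@yequiv_trans _ _ _ _ (ysum e1' e2)).
  apply: (@yequiv_map _ _ _ _ _ _ (fun e => ysum e e2)) l1 => e e' l.
  by have := ladder_sum l (ladder_id e2); rewrite !diag2_id.
apply: yequiv_map l2 => e e' l.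
by have := ladder_sum (ladder_id e1') l; rewrite !diag2_id.
Qed.

Lemma ybaer_equiv m X Z (e1 e1' e2 e2' : yext m X Z) :
  yequiv e1 e1' -> yequiv e2 e2' -> yequiv (ybaer e1 e2) (ybaer e1' e2').
Proof. by move=> ? ?; apply/ypush_equiv/ypull_equiv/ysum_equiv. Qed.

Lemma ycons_equiv m X K Z (c c' : yext 0 X K) (e e' : yext m K Z) :
  yequiv c c' -> yequiv e e' -> yequiv (ycons c e) (ycons c' e').
Proof.
move=> lc le; apply: (@yequiv_trans _ _ _ _ (ycons (c' : conflation X K) e)).
  by apply: (@yequiv_map 0 _ _ _ _ _ (fun c0 => ycons c0 e)) lc => ? ?;
    apply: ycons_monol.
by apply: yequiv_map le => ? ?; apply: ycons_monor.
Qed.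

HB.instance Definition _ m X Z := gen_eqMixin (yext m X Z).
HB.instance Definition _ m X Z := gen_choiceMixin (yext m X Z).

Canonical yequiv_equiv_rel m X Z := EquivRelPack (yequiv_is_equiv m X Z).
Canonical yequiv_encModRel m X Z := defaultEncModRel (@yequiv m X Z).

Definition extq m X Z := {eq_quot @yequiv m X Z}.

HB.instance Definition _ m X Z := EqQuotient.on (extq m X Z).
HB.instance Definition _ m X Z := Choice.on (extq m X Z).

(* Yoneda class of an extension of length m.+1. *)
Definition ycl m X Z (e : yext m X Z) : extq m X Z := \pi_(extq m X Z) e.

Lemma yclP m X Z (e e' : yext m X Z) : ycl e = ycl e' <-> yequiv e e'.
Proof. by split=> h; apply/(@eqmodP _ (yequiv_equiv_rel m X Z)). Qed.

Lemma ycl_repr m X Z (x : extq m X Z) : ycl (repr x) = x.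
Proof. exact: reprK. Qed.

Definition qpush m X X' Z (f : hom X X') (x : extq m X Z) : extq m X' Z :=
  ycl (ypush f (repr x)).

Definition qpull m X Z Z' (x : extq m X Z) (g : hom Z' Z) : extq m X Z' :=
  ycl (ypull g (repr x)).

Definition qsum m X Z X' Z' (x : extq m X Z) (x' : extq m X' Z') :
  extq m (objD X X') (objD Z Z') := ycl (ysum (repr x) (repr x')).

Definition qsplice m X K Z (x : extq 0 X K) (y : extq m K Z) : extq m.+1 X Z :=
  ycl (ycons (repr x) (repr y)).

Definition qadd m X Z (x y : extq m X Z) : extq m X Z :=
  ycl (ybaer (repr x) (repr y)).

Definition qzero m X Z : extq m X Z := ycl (ysplit m X Z).

Definition qopp m X Z (x : extq m X Z) : extq m X Z := qpush (- idm X) x.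

Lemma repr_ycl m X Z (e : yext m X Z) : yequiv (repr (ycl e)) e.
Proof. by apply/yclP; rewrite ycl_repr. Qed.

Lemma qpushE m X X' Z (f : hom X X') (e : yext m X Z) :
  qpush f (ycl e) = ycl (ypush f e).
Proof. by apply/yclP/ypush_equiv/repr_ycl. Qed.

Lemma qpullE m X Z Z' (g : hom Z' Z) (e : yext m X Z) :
  qpull (ycl e) g = ycl (ypull g e).
Proof. by apply/yclP/ypull_equiv/repr_ycl. Qed.

Lemma qsumE m X Z X' Z' (e : yext m X Z) (e' : yext m X' Z') :
  qsum (ycl e) (ycl e') = ycl (ysum e e').
Proof. by apply/yclP/ysum_equiv; apply: repr_ycl. Qed.

Lemma qspliceE m X K Z (c : yext 0 X K) (e : yext m K Z) :
  qsplice (ycl c) (ycl e) = ycl (ycons c e).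
Proof. by apply/yclP/ycons_equiv; apply: repr_ycl. Qed.

Lemma qaddE m X Z (e e' : yext m X Z) :
  qadd (ycl e) (ycl e') = ycl (ybaer e e').
Proof. by apply/yclP/ybaer_equiv; apply: repr_ycl. Qed.

Lemma qladder m X Z X' Z' (f : hom X X') (g : hom Z Z') (e : yext m X Z)
  (e' : yext m X' Z') : ladder f g e e' -> qpush f (ycl e) = qpull (ycl e') g.
Proof.
by move=> l; rewrite qpushE qpullE; apply/yclP/ladder_equiv/ladder_push_pull.
Qed.

Lemma qpush1 m X Z (x : extq m X Z) : qpush (idm X) x = x.
Proof.
rewrite -[x]ycl_repr qpushE; apply/yclP/yequiv_sym/ladder_equiv.
exact: ypush_ladder.
Qed.

Lemma qpull1 m X Z (x : extq m X Z) : qpull x (idm Z) = x.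
Proof.
rewrite -[x]ycl_repr qpullE; apply/yclP/ladder_equiv; exact: ypull_ladder.
Qed.

Lemma qpush_comp m X X' X'' Z (f : hom X X') (f' : hom X' X'') (x : extq m X Z) :
  qpush (f' \oc f) x = qpush f' (qpush f x).
Proof.
rewrite -[x]ycl_repr !qpushE; apply/yclP/ladder_equiv/ypush_univ.
have := ladder_comp (ypush_ladder f (repr x)) (ypush_ladder f' _).
by rewrite !comp1m.
Qed.

Lemma qpull_comp m X Z Z' Z'' (g : hom Z' Z) (g' : hom Z'' Z') (x : extq m X Z) :
  qpull x (g \oc g') = qpull (qpull x g) g'.
Proof.
rewrite -[x]ycl_repr !qpullE; apply/yclP/yequiv_sym/ladder_equiv/ypull_univ.
have := ladder_comp (ypull_ladder g' _) (ypull_ladder g (repr x)).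
by rewrite !compm1.
Qed.

Lemma qpush_pull m X X' Z Z' (f : hom X X') (g : hom Z' Z) (x : extq m X Z) :
  qpush f (qpull x g) = qpull (qpush f x) g.
Proof.
rewrite -[x]ycl_repr qpullE (qpushE f (repr x)); apply: qladder.
have := ladder_comp (ypull_ladder g (repr x)) (ypush_ladder f _).
by rewrite compm1 comp1m.
Qed.

Lemma qpush_sum m X1 X1' Z1 X2 X2' Z2 (f1 : hom X1 X1') (f2 : hom X2 X2')
    (x1 : extq m X1 Z1) (x2 : extq m X2 Z2) :
  qpush (diag2 f1 f2 : hom (objD _ _) (objD _ _)) (qsum x1 x2)
    = qsum (qpush f1 x1) (qpush f2 x2).
Proof.
have := ladder_sum (ypush_ladder f1 (repr x1)) (ypush_ladder f2 (repr x2)).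
rewrite diag2_id => /qladder; rewrite qpull1 -(qsumE (ypush _ _)).
exact.
Qed.

Lemma qpull_sum m X1 Z1 Z1' X2 Z2 Z2' (g1 : hom Z1' Z1) (g2 : hom Z2' Z2)
    (x1 : extq m X1 Z1) (x2 : extq m X2 Z2) :
  qpull (qsum x1 x2) (diag2 g1 g2 : hom (objD _ _) (objD _ _))
    = qsum (qpull x1 g1) (qpull x2 g2).
Proof.
have := ladder_sum (ypull_ladder g1 (repr x1)) (ypull_ladder g2 (repr x2)).
rewrite diag2_id => /qladder; rewrite qpush1 -(qsumE (ypull _ _)).
exact: esym.
Qed.

Lemma conf_mor_diag X Z (c : conflation X Z) :
  @conf_mor X Z (objD X X) (objD Z Z) (col2 (idm X) (idm X))
    (col2 (idm Z) (idm Z)) c (conf_sum c c).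
Proof.
exists (col2 (idm _) (idm _) : hom (cmid c) (objD (cmid c) (cmid c))).
by rewrite /= !diag2_col2 !col2_comp !comp1m !compm1.
Qed.

Lemma ladder_diag m X Z (e : yext m X Z) :
  @ladder m X Z (objD X X) (objD Z Z) (col2 (idm X) (idm X))
    (col2 (idm Z) (idm Z)) e (ysum e e).
Proof.
elim: m X e => /= [|m IH] X e; first exact: conf_mor_diag.
exists (col2 (idm _) (idm _) : hom _ (objD _ _)).
by split; [apply: conf_mor_diag | apply: IH].
Qed.

Definition swap2 X Y : hom (objD X Y) (objD Y X) := col2 pr2 pr1.

Lemma conf_mor_swap X Z X' Z' (c : conflation X Z) (c' : conflation X' Z') :
  conf_mor (swap2 X X') (swap2 Z Z') (conf_sum c c') (conf_sum c' c).
Proof.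
exists (swap2 (cmid c) (cmid c')).
by rewrite /= /swap2 !diag2_col2 !col2_comp /diag2 !pr1_col2 !pr2_col2.
Qed.

Lemma ladder_swap m X Z X' Z' (e : yext m X Z) (e' : yext m X' Z') :
  ladder (swap2 X X') (swap2 Z Z') (ysum e e') (ysum e' e).
Proof.
elim: m X X' e e' => /= [|m IH] X X' e e'; first exact: conf_mor_swap.
by exists (swap2 _ _); split; [apply: conf_mor_swap | apply: IH].
Qed.

Definition assoc2 X Y T :
    hom (objD (objD X Y) T) (objD X (objD Y T)) :=
  col2 (pr1 \oc pr1) (col2 (pr2 \oc pr1) pr2).

Lemma assoc2_diag2 X Y T X' Y' T' (f : hom X X') (g : hom Y Y') (h : hom T T') :
  assoc2 X' Y' T' \oc diag2 (diag2 f g) h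
    = diag2 f (diag2 g h) \oc assoc2 X Y T.
Proof.
rewrite /assoc2 !diag2_col2 !col2_comp.
by do !(rewrite -?compA /diag2 ?pr1_col2 ?pr2_col2; rewrite ?compA ?pr1_col2 ?pr2_col2).
Qed.

Lemma conf_mor_assoc X Z X' Z' X'' Z'' (c : conflation X Z)
    (c' : conflation X' Z') (c'' : conflation X'' Z'') :
  conf_mor (assoc2 X X' X'') (assoc2 Z Z' Z'')
    (conf_sum (conf_sum c c') c'') (conf_sum c (conf_sum c' c'')).
Proof.
by exists (assoc2 (cmid c) (cmid c') (cmid c'')); split; rewrite /= ?assoc2_diag2.
Qed.

Lemma ladder_assoc m X Z X' Z' X'' Z'' (e : yext m X Z) (e' : yext m X' Z')
    (e'' : yext m X'' Z'') :
  ladder (assoc2 X X' X'') (assoc2 Z Z' Z'')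
    (ysum (ysum e e') e'') (ysum e (ysum e' e'')).
Proof.
elim: m X X' X'' e e' e'' => /= [|m IH] X X' X'' e e' e''.
  exact: conf_mor_assoc.
by exists (assoc2 _ _ _); split; [apply: conf_mor_assoc | apply: IH].
Qed.

Lemma ladder_split m X Z X' (e : yext m X Z) :
  ladder (0 : hom X X') (idm Z) e (ysplit m X' Z).
Proof.
elim: m X X' e => /= [|m IH] X X' e.
  exists (in2 \oc cdef e : hom _ (objD X' Z)); rewrite /= compm0 -compA.
  have [_ [-> _]] := cexact e.
  by rewrite compm0 compA pr2in2.
exists 0; split; last exact: IH.
by exists 0; rewrite /= !comp0m compm0.
Qed.

Definition fold2 X : hom (objD X X) X := row2 (idm X) (idm X).
Definition dup2 X : hom X (objD X X) := col2 (idm X) (idm X).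

Lemma qaddqE m X Z (x y : extq m X Z) :
  qadd x y = qpush (fold2 X) (qpull (qsum x y) (dup2 Z)).
Proof. by rewrite /qsum qpullE qpushE. Qed.

Lemma qsum_dup m X Z (x : extq m X Z) :
  qpull (qsum x x) (dup2 Z) = qpush (dup2 X) x.
Proof.
by have := qladder (ladder_diag (repr x)); rewrite -qsumE !ycl_repr => ->.
Qed.

Lemma qaddDl m X X' Z (f f' : hom X X') (x : extq m X Z) :
  qadd (qpush f x) (qpush f' x) = qpush (f + f') x.
Proof.
rewrite qaddqE -qpush_sum -qpush_pull qsum_dup -!qpush_comp; congr (qpush _ x).
by rewrite /fold2 /dup2 row2_diag2 !comp1m row2_col2 !compm1.
Qed.

Lemma qpush0 m X X' Z (x : extq m X Z) : qpush (0 : hom X X') x = qzero m X' Z.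
Proof.
by have := qladder (ladder_split X' (repr x)); rewrite ycl_repr qpull1.
Qed.

Lemma qpushD m X X' Z (f : hom X X') (x y : extq m X Z) :
  qpush f (qadd x y) = qadd (qpush f x) (qpush f y).
Proof.
rewrite !qaddqE -qpush_sum -qpush_pull -!qpush_comp; congr (qpush _ _).
by rewrite /fold2 row2_diag2 comp_row2 !comp1m compm1.
Qed.

Lemma qpullD m X Z Z' (g : hom Z' Z) (x y : extq m X Z) :
  qpull (qadd x y) g = qadd (qpull x g) (qpull y g).
Proof.
rewrite !qaddqE -qpull_sum -qpush_pull -!qpull_comp; congr (qpush _ (qpull _ _)).
by rewrite /dup2 diag2_col2 col2_comp !compm1 comp1m.
Qed.

Lemma qaddC m X Z : commutative (@qadd m X Z).
Proof.
move=> x y; have := qladder (ladder_swap (repr x) (repr y)).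
rewrite -!qsumE !ycl_repr !qaddqE => sw.
have -> : dup2 Z = swap2 Z Z \oc dup2 Z.
  by rewrite /swap2 /dup2 col2_comp pr1_col2 pr2_col2.
rewrite (qpull_comp _ _ (qsum y x)) -sw.
have -> : swap2 Z Z \oc dup2 Z = dup2 Z.
  by rewrite /swap2 /dup2 col2_comp pr1_col2 pr2_col2.
rewrite -qpush_pull -qpush_comp; congr (qpush _ _).
by rewrite /fold2 /swap2 row2_col2 /row2 !comp1m addrC.
Qed.

Lemma qaddA m X Z : associative (@qadd m X Z).
Proof.
move=> x y z; have := qladder (ladder_assoc (repr x) (repr y) (repr z)).
rewrite -!qsumE !ycl_repr => asc.
have eA : qadd x (qadd y z) = qpush (fold2 X \oc
    (diag2 (idm X) (fold2 X) : hom (objD _ _) (objD _ _)))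
    (qpull (qsum x (qsum y z))
      ((diag2 (idm Z) (dup2 Z) : hom (objD _ _) (objD _ _)) \oc dup2 Z)).
  rewrite qaddqE (qaddqE y z) qpush_comp qpull_comp qpull_sum qpull1.
  by rewrite [in RHS]qpush_pull qpush_sum qpush1.
have eB : qadd (qadd x y) z = qpush (fold2 X \oc
    (diag2 (fold2 X) (idm X) : hom (objD _ _) (objD _ _)))
    (qpull (qsum (qsum x y) z)
      ((diag2 (dup2 Z) (idm Z) : hom (objD _ _) (objD _ _)) \oc dup2 Z)).
  rewrite qaddqE (qaddqE x y) qpush_comp qpull_comp qpull_sum qpull1.
  by rewrite [in RHS]qpush_pull qpush_sum qpush1.
rewrite eA eB.
have -> : (diag2 (idm Z) (dup2 Z) : hom (objD _ _) (objD _ _)) \oc dup2 Z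
  = assoc2 Z Z Z
      \oc ((diag2 (dup2 Z) (idm Z) : hom (objD _ _) (objD _ _)) \oc dup2 Z).
  rewrite /dup2 !diag2_col2 /assoc2 !col2_comp ?compm1 ?comp1m -!compA.
  by rewrite ?pr1_col2 ?pr2_col2 ?pr1_col2 ?pr2_col2.
rewrite (qpull_comp _ _ (qsum x _)) -asc -qpush_pull -qpush_comp.
congr (qpush _ _); rewrite /fold2 !row2_diag2 ?compm1 ?comp1m /assoc2.
by rewrite row2_col2 row2_col2 !comp1m /row2 compDl !comp1m addrA.
Qed.

Lemma qadd0 m X Z : left_id (qzero m X Z) (@qadd m X Z).
Proof.
by move=> x; rewrite -(qpush0 X x) -{2}[x]qpush1 qaddDl add0r qpush1.
Qed.

Lemma qaddN m X Z : left_inverse (qzero m X Z) (@qopp m X Z) (@qadd m X Z).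
Proof. by move=> x; rewrite -{2}[x]qpush1 qaddDl addNr qpush0. Qed.

HB.instance Definition _ m X Z := GRing.isZmodule.Build (extq m X Z)
  (@qaddA m X Z) (@qaddC m X Z) (@qadd0 m X Z) (@qaddN m X Z).

(* Ext n Z X is the group Ext^n(Z, X), whose elements have left end X. *)
Definition Ext (n : nat) Z X : zmodType :=
  if n is m.+1 then extq m X Z else hom Z X.

Definition ext_push (n : nat) X X' Z (f : hom X X') :
    Ext n Z X -> Ext n Z X' :=
  match n return Ext n Z X -> Ext n Z X' with
  | 0 => fun h => f \oc h
  | m.+1 => fun x => qpush f x
  end.

(* The Yoneda product of an extension of length 1 with one of length n. *)
Definition ext_mul (n : nat) X K Z (x : Ext 1 K X) :
    Ext n Z K -> Ext n.+1 Z X :=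
  match n return Ext n Z K -> Ext n.+1 Z X with
  | 0 => fun g => qpull (x : extq 0 X K) g
  | m.+1 => fun y => qsplice x y
  end.

Lemma ext_pushD n X X' Z (f : hom X X') :
  {morph @ext_push n X X' Z f : x y / x + y}.
Proof. by case: n => [|m] x y /=; [apply: compDr | apply: qpushD]. Qed.

Lemma ext_push1 n X Z (x : Ext n Z X) : ext_push (idm X) x = x.
Proof. by case: n x => [|m] x /=; [apply: comp1m | apply: qpush1]. Qed.

Lemma ext_push_comp n X X' X'' Z (f : hom X X') (f' : hom X' X'')
  (x : Ext n Z X) : ext_push (f' \oc f) x = ext_push f' (ext_push f x).
Proof. by case: n x => [|m] x /=; [rewrite compA | apply: qpush_comp]. Qed.

Definition conf_class X Z (c : conflation X Z) : Ext 1 Z X :=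
  ycl (c : yext 0 X Z).

(* Functors from C to abelian groups, and the group of natural transformations
   between two of them. *)
Record abfunctor := AbFunctor {
  fobj :> obj C -> zmodType;
  fmap : forall X Y, hom X Y -> fobj X -> fobj Y;
  fmapD : forall X Y (f : hom X Y), {morph fmap f : x y / x + y};
  fmap1 : forall X (x : fobj X), fmap (idm X) x = x;
  fmap_comp : forall X Y T (f : hom X Y) (g : hom Y T) (x : fobj X),
    fmap (g \oc f) x = fmap g (fmap f x)
}.

Record Nat (F G : abfunctor) := NatTrans {
  napp :> forall T, F T -> G T;
  nappD : forall T, {morph @napp T : x y / x + y};
  napp_natural : forall X Y (f : hom X Y) (x : F X),
    napp (fmap f x) = fmap f (napp x)
}.
Arguments napp {F G} n T x : rename.

Definition ExtF (n : nat) Z : abfunctor :=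
  @AbFunctor (fun X => Ext n Z X) (fun X X' f => @ext_push n X X' Z f)
    (fun X X' f => @ext_pushD n X X' Z f) (fun X => @ext_push1 n X Z)
    (fun X Y T f g => @ext_push_comp n X Y T Z f g).

Section NatGroup.
Variables F G : abfunctor.

Lemma nat_ext (a b : Nat F G) : (forall T x, a T x = b T x) -> a = b.
Proof.
case: a b => [a aD an] [b bD bn] /= ab.
have e : a = b by apply: functional_extensionality_dep => T; apply/funext => x.
by case: _ / e bD bn => bD bn; congr NatTrans; apply: Prop_irrelevance.
Qed.

Lemma morphD0 (U V : zmodType) (h : U -> V) :
  {morph h : x y / x + y} -> h 0 = 0.
Proof. by move=> hD; apply: (@addrI _ (h 0)); rewrite -hD !addr0. Qed.

Lemma fmap0 (H : abfunctor) X Y (f : hom X Y) : fmap f (0 : H X) = 0.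
Proof. exact/morphD0/fmapD. Qed.

Lemma fmapN (H : abfunctor) X Y (f : hom X Y) (x : H X) :
  fmap f (- x) = - fmap f x.
Proof. by apply: (@addrI _ (fmap f x)); rewrite -fmapD !subrr fmap0. Qed.

Definition nat_zero : Nat F G.
Proof.
exists (fun T _ => 0) => [T x y|X Y f x]; first by rewrite addr0.
by rewrite fmap0.
Defined.

Definition nat_opp (a : Nat F G) : Nat F G.
Proof.
exists (fun T x => - a T x) => [T x y|X Y f x]; first by rewrite nappD opprD.
by rewrite napp_natural fmapN.
Defined.

Definition nat_add (a b : Nat F G) : Nat F G.
Proof.
exists (fun T x => a T x + b T x) => [T x y|X Y f x].
  by rewrite !nappD addrACA.
by rewrite !napp_natural fmapD.
Defined.

Lemma nat_addA : associative nat_add.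
Proof. by move=> a b c; apply: nat_ext => T x /=; rewrite addrA. Qed.

Lemma nat_addC : commutative nat_add.
Proof. by move=> a b; apply: nat_ext => T x /=; rewrite addrC. Qed.

Lemma nat_add0 : left_id nat_zero nat_add.
Proof. by move=> a; apply: nat_ext => T x /=; rewrite add0r. Qed.

Lemma nat_addN : left_inverse nat_zero nat_opp nat_add.
Proof. by move=> a; apply: nat_ext => T x /=; rewrite addNr. Qed.

HB.instance Definition _ := gen_eqMixin (Nat F G).
HB.instance Definition _ := gen_choiceMixin (Nat F G).
HB.instance Definition _ :=
  GRing.isZmodule.Build (Nat F G) nat_addA nat_addC nat_add0 nat_addN.

End NatGroup.

Section ProjectiveFactors.
Variables (n : nat) (M X : obj C).

Definition proj_ext : {pred Ext n M X} := fun x =>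
  `[< exists P : obj C, projective P /\
      exists (f : hom P X) (b : Ext n M P), x = ext_push f b >].

Lemma projective0 : projective obj0.
Proof.
by move=> Y Z c f; exists 0; rewrite compm0 -[RHS]compm1 zero_obP compm0.
Qed.

Lemma projectiveD P Q : projective P -> projective Q -> projective (objD P Q).
Proof.
move=> pP pQ Y Z c f.
have [u uE] := pP _ _ c (f \oc in1); have [v vE] := pQ _ _ c (f \oc in2).
exists (row2 u v); rewrite comp_row2 uE vE.
by rewrite -comp_row2 /row2 inprD compm1.
Qed.

Lemma ext_push0 n' X' Z (f : hom X' X) : ext_push f (0 : Ext n' Z X') = 0.
Proof. exact/morphD0/ext_pushD. Qed.

Lemma proj_ext_zmod_closed : zmod_closed proj_ext.
Proof.
split=> [|x y]; first apply/asboolP.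
  by exists obj0; split; [apply: projective0|exists 0, 0; rewrite ext_push0].
move=> /asboolP[P [pP [f [b ->]]]] /asboolP[Q [pQ [g [c ->]]]]; apply/asboolP.
exists (objD P Q); split; first exact: projectiveD.
exists (row2 f g), (ext_push (in1 : hom P (objD P Q)) b
  - ext_push (in2 : hom Q (objD P Q)) c).
have rowE := @ext_push_comp n _ (objD P Q) X M _ (row2 f g).
rewrite ext_pushD -rowE row2_in1; congr (_ + _).
apply: (@addrI _ (ext_push g c)); rewrite subrr.
have -> : ext_push g c = ext_push (row2 f g : hom (objD P Q) X)
    (ext_push (in2 : hom Q (objD P Q)) c) by rewrite -rowE row2_in2.
by rewrite -ext_pushD subrr ext_push0.
Qed.

HB.instance Definition _ :=
  GRing.isZmodClosed.Build (Ext n M X) proj_ext proj_ext_zmod_closed.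

(* The quotient of Ext^n(M, X) by the subgroup proj_ext. *)
Definition ext_mod_proj : zmodType := Quotient.quot proj_ext.

Definition ext_class (x : Ext n M X) : ext_mod_proj :=
  \pi_(Quotient.quot proj_ext) x.

End ProjectiveFactors.

Fixpoint all_proj (m : nat) X Z : yext m X Z -> Prop :=
  match m return yext m X Z -> Prop with
  | 0 => fun e => projective (cmid e)
  | m'.+1 => fun e =>
      projective (cmid (projT2 e).1) /\ all_proj (projT2 e).2
  end.

(* syzygy N n W: the syzygy sequences of length n from W = Omega^n N to N;
   syz0 is the identity of N. *)
Inductive syzygy (N : obj C) : nat -> obj C -> Type :=
| syz0 : syzygy N 0 N
| syzS m W (e : yext m W N) : all_proj e -> syzygy N m.+1 W.

(* The extension a delta; pulling back along the identity changes nothing. *)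
Definition splice_syz N n W T (a : conflation T W) (d : syzygy N n W) :
    yext n T N :=
  match d in syzygy _ n' W' return conflation T W' -> yext n' T N with
  | syz0 => fun a => a
  | syzS m W' e _ => fun a => ycons a e
  end a.

End ExactStructure.

(* Main.v *)
(** Splicing with a syzygy sequence [d] of length [n] from [W] to [N] is a
    natural bijection [Ext^1(W, T) -> Ext^(n+1)(N, T)]: it is surjective because
    the identity of [N] lifts to a ladder out of the projective sequence [d], and
    injective because two such lifts differ, on [W], by a map factoring through
    a projective, along which every element of [Ext^1] pulls back to 0.
    Hence [Psi gamma] is multiplication by [gamma] up to this identification.

    Let [om : K -> P -> W] be a conflation with [P] projective; every element
    of [Ext^1(W, T)] is a push-out of [om], so [Psi gamma] is determined by
    [om gamma].  Writing [gamma = h dM] with [dM] a syzygy sequence of [M], the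
    vanishing of [om gamma = (om h) dM] forces [om h = 0], i.e. [h] factors
    through [P].  Conversely, given [F], write [F (om d) = a dM]; since the
    push-out of [om] along [K -> P] is 0, so is that of [a], hence [K -> P]
    extends over the middle term of [a], which shows [a = om g] for some [g],
    and [F = Psi (g dM)]. *)

Require Import Defs.
From HB Require Import structures.
From mathcomp Require Import all_boot all_algebra.
From mathcomp Require Import boolp.

Set Implicit Arguments.
Unset Strict Implicit.
Unset Printing Implicit Defensive.

Import GRing.Theory.
Local Open Scope ring_scope.

Section Yoneda.
Import Defs.
Variables (A : abelian) (C : subcat A).
Implicit Types X Y Z T K M N P W : obj C.

(** * Conflations: factorization, splitting and vanishing in Ext^1 *)

Lemma cdef_cinf X Z (c : conflation X Z) : cdef c \oc cinf c = 0.
Proof. by have [[]] := cexact c. Qed.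

Lemma cinf_monic X Z (c : conflation X Z) : monic (cinf c).
Proof. by have [/kernel_monic] := cexact c. Qed.

Lemma cdef_epic X Z (c : conflation X Z) : epic (cdef c).
Proof. by have [_ /cokernel_epic] := cexact c. Qed.

Lemma cinf_factor X Z (T : A) (c : conflation X Z) (u : hom T (cmid c)) :
  cdef c \oc u = 0 -> exists v : hom T X, cinf c \oc v = u.
Proof. by have [[_ univ] _] := cexact c => /univ[v [? _]]; exists v. Qed.

Lemma cdef_factor X Z (T : A) (c : conflation X Z) (u : hom (cmid c) T) :
  u \oc cinf c = 0 -> exists v : hom Z T, v \oc cdef c = u.
Proof. by have [_ [_ univ]] := cexact c => /univ[v [? _]]; exists v. Qed.

Lemma compBl X Y Z (g g' : hom Y Z) (f : hom X Y) :
  (g - g') \oc f = g \oc f - g' \oc f.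
Proof. by rewrite compDl compNl. Qed.

Lemma compBr X Y Z (g : hom Y Z) (f f' : hom X Y) :
  g \oc (f - f') = g \oc f - g \oc f'.
Proof. by rewrite compDr compNr. Qed.

Lemma conf_mor_of_cdef X Z X' Z' (c : conflation X Z) (c' : conflation X' Z')
    (x : hom (cmid c) (cmid c')) (g : hom Z Z') :
  cdef c' \oc x = g \oc cdef c -> exists f : hom X X', conf_mor f g c c'.
Proof.
move=> px; have [|f fE] := @cinf_factor _ _ _ c' (x \oc cinf c).
  by rewrite compA px -compA cdef_cinf compm0.
by exists f, x.
Qed.

Lemma conf_mor_of_cinf X Z X' Z' (c : conflation X Z) (c' : conflation X' Z')
    (x : hom (cmid c) (cmid c')) (f : hom X X') :
  x \oc cinf c = cinf c' \oc f -> exists g : hom Z Z', conf_mor f g c c'.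
Proof.
move=> xi; have [|g gE] := @cdef_factor _ _ _ c (cdef c' \oc x).
  by rewrite -compA xi compA cdef_cinf comp0m.
by exists g, x.
Qed.

Lemma section_retraction X Z (c : conflation X Z) :
  (exists s : hom Z (cmid c), cdef c \oc s = idm Z) <->
  (exists r : hom (cmid c) X, r \oc cinf c = idm X).
Proof.
split=> [[s ps]|[r ri]].
  have [|r rE] := @cinf_factor _ _ _ c (idm _ - s \oc cdef c).
    by rewrite compBr compA ps compm1 comp1m subrr.
  exists r; apply: (@cinf_monic _ _ c); rewrite compA rE compBl -compA.
  by rewrite cdef_cinf compm0 subr0 comp1m compm1.
have [|s sE] := @cdef_factor _ _ _ c (idm _ - cinf c \oc r).
  by rewrite compBl -compA ri compm1 comp1m subrr.
exists s; apply: (@cdef_epic _ _ c); rewrite -compA sE compBr compA cdef_cinf.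
by rewrite comp0m subr0 comp1m compm1.
Qed.

(** Sections compose forward with the rung [x] and retractions compose backward with it, which gives
    both directions. *)
Lemma section_conf_mor X Z (c c' : conflation X Z) :
  conf_mor (idm X) (idm Z) c c' ->
  (exists s : hom Z (cmid c), cdef c \oc s = idm Z) <->
  (exists s : hom Z (cmid c'), cdef c' \oc s = idm Z).
Proof.
move=> [x [xi px]]; split=> [[s sE]|].
  by exists (x \oc s); rewrite compA px -compA sE compm1.
move=> /section_retraction[r rE]; apply/section_retraction.
by exists (r \oc x); rewrite -compA xi compm1 rE.
Qed.

Lemma yequiv_section X Z (c c' : yext 0 X Z) : yequiv c c' ->
  (exists s : hom Z (cmid c), cdef c \oc s = idm Z) <->
  (exists s : hom Z (cmid c'), cdef c' \oc s = idm Z).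
Proof.
move/yequivP; elim=> [? ? /section_conf_mor|//|? ? _ []|? ? ? _ [? ?] _ [? ?]].
- exact.
- by split.
- by split; auto.
Qed.

Lemma conf_class0P X Z (c : conflation X Z) :
  conf_class c = 0 <-> exists s : hom Z (cmid c), cdef c \oc s = idm Z.
Proof.
split=> [/(yclP (c : yext 0 X Z))/yequiv_section[_]|[s sE]].
  (* The zero class is that of [conf_split], which [in2] splits. *)
  by apply; exists in2; rewrite /= pr2in2.
apply/esym/yclP/ladder_equiv.
exists (row2 (cinf c) s : hom (objD X Z) _); rewrite /= row2_in1 compm1 comp1m.
by rewrite comp_row2 cdef_cinf sE /row2 comp0m comp1m add0r.
Qed.

Lemma conf_class0_retract X Z (c : conflation X Z) :
  conf_class c = 0 <-> exists r : hom (cmid c) X, r \oc cinf c = idm X.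
Proof. by rewrite conf_class0P section_retraction. Qed.

Lemma conf_classE X Z (x : Ext 1 Z X) : exists c : conflation X Z,
  x = conf_class c.
Proof. by exists (repr (x : extq 0 X Z)); rewrite /conf_class ycl_repr. Qed.

(** By the universal property of the pull-back, its sections are the lifts of [g] through the
    deflation. This is exactness at [Hom(Z', Z)] of the long exact sequence. *)
Lemma qpull_conf0 X Z Z' (c : conflation X Z) (g : hom Z' Z) :
  qpull (conf_class c) g = 0 <-> exists h : hom Z' (cmid c), cdef c \oc h = g.
Proof.
rewrite qpullE -[ycl _]/(conf_class (conf_pull c g)) conf_class0P.
have [x [xi px]] := conf_pull_mor c g.
split=> [[s sE]|[h hE]].
  by exists (x \oc s); rewrite compA px -compA sE compm1.
have [|u _ uE] := @pullback_univ _ _ _ _ (cdef c) g _ h (idm Z').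
  by rewrite compm1.
by exists u.
Qed.

Lemma qpush_conf0 X X' Z (c : conflation X Z) (f : hom X X') :
  qpush f (conf_class c) = 0 <-> exists h : hom (cmid c) X', h \oc cinf c = f.
Proof.
rewrite qpushE -[ycl _]/(conf_class (conf_push f c)) conf_class0_retract.
have [x [xi px]] := conf_push_mor f c.
split=> [[r rE]|[h hE]].
  by exists (r \oc x); rewrite -compA xi compA rE comp1m.
have [|u _ uE] := @pushout_univ _ _ _ _ (cinf c) f _ h (idm X').
  by rewrite comp1m.
by exists u.
Qed.

(** * Biadditivity and associativity of the Yoneda product *)

Lemma qsum_fold m X Z (x : extq m X Z) :
  qpush (fold2 X) (qsum x x) = qpull x (fold2 Z).
Proof.
rewrite -[x]ycl_repr qsumE; apply: qladder.
move: (repr x) => {x} e; elim: m X e => /= [|m IH] X e.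
  exists (fold2 (cmid e) : hom (objD _ _) _).
  by rewrite /fold2 /= !row2_diag2 !comp_row2 !comp1m !compm1.
exists (fold2 _); split; last exact: IH.
exists (fold2 (cmid (projT2 e).1) : hom (objD _ _) _).
by rewrite /fold2 /= !row2_diag2 !comp_row2 !comp1m !compm1.
Qed.

Lemma qpullDr m X Z Z' (x : extq m X Z) :
  {morph (fun g : hom Z' Z => qpull x g) : g g' / g + g'}.
Proof.
move=> g g'; rewrite [RHS]qaddqE -qpull_sum -qpull_comp qpush_pull qsum_fold.
rewrite -qpull_comp; congr (qpull x _).
by rewrite /fold2 /dup2 diag2_col2 row2_col2 !comp1m !compm1.
Qed.

(** The map [k] itself joins the splicing objects in a ladder with fixed ends. *)
Lemma qsplice_pull m X K K' Z (x : extq 0 X K) (k : hom K' K)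
  (y : extq m K' Z) : qsplice (qpull x k) y = qsplice x (qpush k y).
Proof.
rewrite -[x]ycl_repr -[y]ycl_repr qpullE qpushE !qspliceE.
apply/yclP/ladder_equiv; exists k; split; last exact: ypush_ladder.
exact: conf_pull_mor.
Qed.

Lemma qpush_splice m X X' K Z (f : hom X X') (x : extq 0 X K)
  (y : extq m K Z) : qpush f (qsplice x y) = qsplice (qpush f x) y.
Proof. by rewrite -[x]ycl_repr -[y]ycl_repr qspliceE !qpushE qspliceE. Qed.

Lemma qpull_splice m X K Z Z' (x : extq 0 X K) (y : extq m K Z)
  (g : hom Z' Z) : qpull (qsplice x y) g = qsplice x (qpull y g).
Proof. by rewrite -[x]ycl_repr -[y]ycl_repr qspliceE !qpullE qspliceE. Qed.

Lemma qsplice_sum m X K Z X' K' Z' (x : extq 0 X K) (y : extq m K Z)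
    (x' : extq 0 X' K') (y' : extq m K' Z') :
  qsum (qsplice x y) (qsplice x' y') = qsplice (qsum x x') (qsum y y').
Proof.
rewrite -[x]ycl_repr -[y]ycl_repr -[x']ycl_repr -[y']ycl_repr.
rewrite (qsumE (repr x) (repr x')) (qsumE (repr y) (repr y')).
by rewrite !qspliceE qsumE.
Qed.

Lemma qspliceDl m X K Z (y : extq m K Z) :
  {morph (fun x : extq 0 X K => qsplice x y) : x x' / x + x'}.
Proof.
move=> x x'; rewrite [RHS]qaddqE qsplice_sum qpull_splice qsum_dup.
(* The diagonal of [K], produced by doubling [y], passes across the splice to the left factor. *)
by rewrite -qsplice_pull qpush_splice -qaddqE.
Qed.

Lemma qspliceDr m X K Z (x : extq 0 X K) :
  {morph (fun y : extq m K Z => qsplice x y) : y y' / y + y'}.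
Proof.
move=> y y'; rewrite [RHS]qaddqE qsplice_sum qpull_splice qpush_splice.
by rewrite qsum_fold qsplice_pull -qaddqE.
Qed.

Lemma ext_mulDl n X K Z (y : Ext n Z K) :
  {morph (fun x : Ext 1 K X => ext_mul x y) : x x' / x + x'}.
Proof.
by case: n y => [|n] y x x' /=; [apply: qpullD | apply: (qspliceDl y)].
Qed.

Lemma ext_mulDr n X K Z (x : Ext 1 K X) :
  {morph (fun y : Ext n Z K => ext_mul x y) : y y' / y + y'}.
Proof. by case: n => [|n] y y' /=; [apply: qpullDr | apply: qspliceDr]. Qed.

Lemma ext_mul0l n X K Z (y : Ext n Z K) : ext_mul (0 : Ext 1 K X) y = 0.
Proof. exact: morphD0 (@ext_mulDl n X K Z y). Qed.

Lemma ext_mul_pull n X K K' Z (x : Ext 1 K X) (k : hom K' K) (y : Ext n Z K') :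
  ext_mul (qpull x k : Ext 1 K' X) y = ext_mul x (ext_push k y).
Proof.
by case: n y => [|n] y /=; [rewrite qpull_comp | apply: qsplice_pull].
Qed.

Lemma ext_push_mul n X X' K Z (f : hom X X') (x : Ext 1 K X) (y : Ext n Z K) :
  ext_push f (ext_mul x y) = ext_mul (ext_push f x) y.
Proof.
by case: n y => [|n] y /=; [apply: qpush_pull | apply: qpush_splice].
Qed.

(** * Ladders out of projective sequences and their homotopies *)

Lemma projective_ext0 P X (x : Ext 1 P X) : projective P -> x = 0.
Proof.
by have [c ->] := conf_classE x => /(_ _ _ c (idm P)) /conf_class0P.
Qed.

(** Comparison theorem, from right to left: each projective term lifts through the next deflation,
    and the lift induces a map on the kernels. *)
Lemma lift_all_proj m X Z X' Z' (g : hom Z Z') (d : yext m X Z)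
    (e : yext m X' Z') : all_proj d -> exists f : hom X X', ladder f g d e.
Proof.
elim: m X X' d e => /= [|m IH] X X' d e.
  move=> /(_ _ _ e (g \oc cdef d))[x /conf_mor_of_cdef //].
move=> [projd /(IH _ _ _ (projT2 e).2)[k kl]].
have [x /conf_mor_of_cdef[f fl]] :=
  projd _ _ (projT2 e).1 (k \oc cdef (projT2 d).1).
by exists f, k.
Qed.

(** Two lifts of one map are compared through their difference, a ladder over 0. *)
Lemma ladderB m X Z X' Z' (f f' : hom X X') (g g' : hom Z Z')
    (d : yext m X Z) (e : yext m X' Z') :
  ladder f g d e -> ladder f' g' d e -> ladder (f - f') (g - g') d e.
Proof.
have confB X1 Z1 X2 Z2 (u u' : hom X1 X2) (v v' : hom Z1 Z2)
    (c1 : conflation X1 Z1) (c2 : conflation X2 Z2) :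
    conf_mor u v c1 c2 -> conf_mor u' v' c1 c2 ->
    conf_mor (u - u') (v - v') c1 c2.
  move=> [x [xi px]] [x' [xi' px']]; exists (x - x').
  by rewrite !compBl !compBr xi px xi' px'.
elim: m X X' f f' d e => /= [|m IH] X X' f f' d e; first exact: confB.
move=> [k [ck lk]] [k' [ck' lk']]; exists (k - k').
by split; [apply: confB | apply: IH].
Qed.

Definition head_mid m X Z : yext m X Z -> obj C :=
  match m return yext m X Z -> obj C with
  | 0 => fun e => cmid e
  | m'.+1 => fun e => cmid (projT2 e).1
  end.

Definition head_inf m X Z : forall e : yext m X Z, hom X (head_mid e) :=
  match m return forall e : yext m X Z, hom X (head_mid e) with
  | 0 => fun e => cinf e
  | m'.+1 => fun e => cinf (projT2 e).1
  end.

Lemma all_proj_head m X Z (d : yext m X Z) :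
  all_proj d -> projective (head_mid d).
Proof. by case: m d => [|m] d //= []. Qed.

(* Ladders over 0 are null-homotopic; only the leftmost homotopy is needed. *)
Lemma ladder0_homotopy m X Z X' Z' (f : hom X X') (d : yext m X Z)
    (e : yext m X' Z') : all_proj d -> ladder f (0 : hom Z Z') d e ->
  exists h : hom (head_mid d) X', f = h \oc head_inf d.
Proof.
elim: m X X' f d e => /= [|m IH] X X' f d e.
  move=> _ [x [xi]]; rewrite comp0m => /cinf_factor[h hE].
  by exists h; apply: (@cinf_monic _ _ e); rewrite compA hE xi.
move=> [projd ad] [k [[x [xi px]] /(IH _ _ _ _ _ ad)[h hE]]].
(* Correcting the rung [x] by a lift [h'] of the previous homotopy [h] makes the deflation kill it;
   its factorization [v] through the inflation is the next homotopy. *)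
have [h' h'E] := all_proj_head ad (projT2 e).1 h.
have [|v vE] := @cinf_factor _ _ _ (projT2 e).1
    (x - h' \oc head_inf (projT2 d).2 \oc cdef (projT2 d).1).
  by rewrite compBr px !compA h'E -hE subrr.
exists v; apply: (@cinf_monic _ _ (projT2 e).1); rewrite compA vE compBl.
by rewrite -!compA cdef_cinf !compm0 subr0 xi.
Qed.

(** The difference [k - k'] factors through a projective, on which Ext^1 vanishes. *)
Lemma qpull_homotopic m X K Z Y (x : extq 0 Y K) (k k' : hom X K)
    (d : yext m X Z) (e : yext m K Z) : all_proj d ->
  ladder k (idm Z) d e -> ladder k' (idm Z) d e -> qpull x k = qpull x k'.
Proof.
move=> ad lk lk'; have := ladderB lk lk'; rewrite subrr.
move=> /(ladder0_homotopy ad)[h hE]; rewrite -[k](subrK k') qpullDr hE.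
rewrite qpull_comp (projective_ext0 (qpull x h) (all_proj_head ad)).
by rewrite (morphD0 (@qpullD _ _ _ _ _ _ _)) add0r.
Qed.

(** The leftmost conflation, pulled back along a lift of the identity, is an invariant of the Yoneda
    class. Quantifying over all lifts lets the induction run along a zigzag of ladders. *)
Lemma yequiv_head m Y X Z (d : yext m X Z) (e e' : yext m.+1 Y Z)
    (k : hom X (projT1 e)) (k' : hom X (projT1 e')) :
  all_proj d -> yequiv e e' ->
  ladder k (idm Z) d (projT2 e).2 -> ladder k' (idm Z) d (projT2 e').2 ->
  qpull (conf_class (projT2 e).1) k = qpull (conf_class (projT2 e').1) k'.
Proof.
move=> ad /yequivP eqv; elim: eqv k k'
  => [{}e {}e' [t [ct lt]]|{}e|{}e {}e' _ IH|{}e e1 {}e' _ IH _ IH'] k k'.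
- move=> lk lk'.
  (* Both [t \oc k] and [k'] lift the identity into [e'], so they are homotopic. *)
  have ltk := ladder_comp lk lt; rewrite comp1m in ltk.
  rewrite -(qpull_homotopic _ ad ltk lk') qpull_comp.
  by rewrite -(qladder (m := 0) ct) qpush1.
- exact: qpull_homotopic.
- by move=> lk lk'; rewrite (IH k' k).
(* Projectivity of [d] supplies a lift into the intermediate sequence [e1]. *)
- move=> lk lk'; have [k1 lk1] := lift_all_proj (idm Z) (projT2 e1).2 ad.
  by rewrite (IH k k1) // (IH' k1 k').
Qed.

(** * Multiplication by a syzygy sequence *)

Definition syz_class N n W (d : syzygy N n W) : Ext n N W :=
  match d in syzygy _ n' W' return Ext n' N W' with
  | syz0 => idm N
  | syzS m W' e _ => ycl e
  end.

Lemma ycl_splice_syz N n W T (a : conflation T W) (d : syzygy N n W) :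
  ycl (splice_syz a d) = ext_mul (conf_class a) (syz_class d).
Proof. by case: d a => [|m W' e ?] a /=; rewrite ?qpull1 ?qspliceE. Qed.

Lemma ext_mul_syz_inj N n W T (d : syzygy N n W) :
  injective (fun a : Ext 1 W T => ext_mul a (syz_class d)).
Proof.
case: d => [|m W' e ae] a a' /=; first by rewrite !qpull1.
have [c ->] := conf_classE a; have [c' ->] := conf_classE a'.
(* The identity ladder of [e] serves as the lift on both sides. *)
rewrite !qspliceE => /yclP /(yequiv_head ae) /(_ (ladder_id e) (ladder_id e)).
by rewrite !qpull1.
Qed.

Lemma splice_syz_surj N n W T (d : syzygy N n W) (e : yext n T N) :
  exists a : conflation T W, ladder_fixed (splice_syz a d) e.
Proof.
case: d e => [|m W' d ad] e /=; first by exists e; apply: (ladder_id (m := 0)).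
have [k kl] := lift_all_proj (idm N) (projT2 e).2 ad.
by exists (conf_pull (projT2 e).1 k), k; split=> //; apply: conf_pull_mor.
Qed.

Lemma ext_mul_syz_surj N n W T (d : syzygy N n W) (x : Ext n.+1 N T) :
  exists a : Ext 1 W T, x = ext_mul a (syz_class d).
Proof.
have [a al] := splice_syz_surj d (repr (x : extq n T N)).
exists (conf_class a); rewrite -ycl_splice_syz.
by rewrite -[LHS]ycl_repr; apply/esym/yclP/ladder_equiv.
Qed.

(** In positive length [d] maps to every sequence ending in [N], and a ladder over the identity
    exhibits its target as a push-out of [d]. *)
Lemma ext_push_syz_surj N n W T (d : syzygy N n W) (x : Ext n N T) :
  exists g : hom W T, x = ext_push g (syz_class d).
Proof.
case: d x => [|m W' d ad] x; first by exists x; rewrite /= compm1.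
have [g gl] := lift_all_proj (idm N) (repr (x : extq m T N)) ad.
by exists g; rewrite /= (qladder gl) qpull1 ycl_repr.
Qed.

Lemma enough_syzygies : enough_projectives C ->
  forall N n, exists W (d : syzygy N n W), True.
Proof.
move=> enough N [|n]; first by exists N, (syz0 N).
suff [W [e ae]] : exists W (e : yext n W N), all_proj e by exists W, (syzS ae).
elim: n => [|n [W [e ae]]].
  by have [X [c pc]] := enough N; exists X, (c : yext 0 X N).
by have [X [c pc]] := enough W; exists X, (ycons c e).
Qed.

(** * Kernel and image of the correspondence *)

Section Psi.
Hypothesis enough : enough_projectives C.
Variables (n : nat) (M N W : obj C) (d : syzygy N n W).

(* The class written alpha_1 in the informal statement. *)
Definition desyz T (x : Ext n.+1 N T) : Ext 1 W T :=
  sval (cid (ext_mul_syz_surj d x)).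

Lemma ext_mul_desyz T (x : Ext n.+1 N T) :
  ext_mul (desyz x) (syz_class d) = x.
Proof. exact/esym/(svalP (cid (ext_mul_syz_surj d x))). Qed.

Lemma desyzK T (a : Ext 1 W T) : desyz (ext_mul a (syz_class d)) = a.
Proof. by apply: (ext_mul_syz_inj (d := d)); rewrite /= ext_mul_desyz. Qed.

Lemma desyzD T : {morph @desyz T : x y / x + y}.
Proof.
move=> x y; apply: (ext_mul_syz_inj (d := d)).
by rewrite /= ext_mulDl !ext_mul_desyz.
Qed.

Lemma desyz_push X Y (f : hom X Y) (x : Ext n.+1 N X) :
  desyz (ext_push f x) = ext_push f (desyz x).
Proof.
apply: (ext_mul_syz_inj (d := d)).
by rewrite /= ext_mul_desyz -ext_push_mul ext_mul_desyz.
Qed.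

Definition Psi (g : Ext n M W) : Nat (ExtF n.+1 N) (ExtF n.+1 M).
Proof.
exists (fun T x => ext_mul (desyz x) g) => [T x y|X Y f x] /=.
  by rewrite desyzD ext_mulDl.
by rewrite (desyz_push f x) -ext_push_mul.
Defined.

Lemma PsiD : {morph Psi : g g' / g + g'}.
Proof. by move=> g g'; apply: nat_ext => T x /=; apply: ext_mulDr. Qed.

Lemma PsiB : {morph Psi : g g' / g - g'}.
Proof.
by move=> g g'; apply: (@addIr _ (Psi g')); rewrite -PsiD !subrK.
Qed.

Lemma Psi_splice (g : Ext n M W) T (a : Ext 1 W T) :
  Psi g T (ext_mul a (syz_class d)) = ext_mul a g.
Proof. by rewrite /= desyzK. Qed.

Lemma Psi_eq0 (g : Ext n M W) : Psi g = 0 <-> g \in @proj_ext A C n M W.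
Proof.
split=> [Psi0|/asboolP[P [pP [f [b ->]]]]].
  have [K [om pom]] := enough W.
  have [V [dM _]] := enough_syzygies enough M n.
  have [h hE] := ext_push_syz_surj dM g.
  (* Evaluating [Psi g] at [om d] gives [om g = (om h) dM = 0], and [dM] cancels. *)
  have : ext_mul (qpull (conf_class om) h : Ext 1 V K) (syz_class dM)
      = ext_mul (0 : Ext 1 V K) (syz_class dM).
    by rewrite ext_mul_pull -hE -Psi_splice Psi0 ext_mul0l.
  move=> /ext_mul_syz_inj /qpull_conf0[h' h'E]; apply/asboolP.
  exists (cmid om); split=> //; exists (cdef om), (ext_push h' (syz_class dM)).
  by rewrite -ext_push_comp h'E.
(* Here [f] moves to the left factor, which then lies in [Ext^1(P, T) = 0]. *)
apply: nat_ext => T x /=; rewrite -ext_mul_pull.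
by rewrite (projective_ext0 (qpull _ _) pP) ext_mul0l.
Qed.

Lemma Psi_surj (F : Nat (ExtF n.+1 N) (ExtF n.+1 M)) :
  exists g, Psi g = F.
Proof.
have [K [om pom]] := enough W; have [V [dM _]] := enough_syzygies enough M n.
pose omd : Ext n.+1 N K := ext_mul (conf_class om : Ext 1 W K) (syz_class d).
have [a0 aE] := ext_mul_syz_surj dM (F K omd : Ext n.+1 M K).
have [a a0E] := conf_classE a0; rewrite {}a0E in aE.
(* Pushing [om] out along its own inflation gives 0; naturality of [F] and cancellation of [dM]
   transfer this to [a]. *)
have [r rE] : exists r : hom (cmid a) (cmid om), r \oc cinf a = cinf om.
  apply/qpush_conf0/(ext_mul_syz_inj (d := dM)).
  have /= <- := ext_push_mul (cinf om) (conf_class a) (syz_class dM).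
  rewrite -aE; have /= <- := napp_natural F (cinf om) omd.
  have /= -> := ext_push_mul (cinf om) (conf_class om) (syz_class d).
  have -> : qpush (cinf om) (conf_class om) = 0.
    by apply/qpush_conf0; exists (idm _); rewrite comp1m.
  by rewrite !ext_mul0l (morphD0 (@nappD _ _ _ _ F _)).
(* As [r] is the identity on [K], it induces [g] on the right ends, so that [a = om g]. *)
have [|g ga] := @conf_mor_of_cinf _ _ _ _ a om r (idm K).
  by rewrite compm1.
exists (ext_push g (syz_class dM)); apply: nat_ext => T x.
have [a' ->] := ext_mul_syz_surj d x.
have [b ->] := conf_classE a'.
(* Lifting [cdef om] through [b] shows that [b] is a push-out of [om]. *)
have [y py] := pom _ _ b (cdef om).
have [|f fb] := @conf_mor_of_cdef _ _ _ _ om b y (idm W).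
  by rewrite comp1m.
have bE : conf_class b = qpush f (conf_class om).
  by rewrite (qladder (m := 0) fb) qpull1.
rewrite Psi_splice bE.
(* Both transformations commute with push-out along [f], so it suffices to compare them on [omd],
   where each gives [a dM]. *)
have /= <- := ext_push_mul f (conf_class om) (syz_class d).
have /= <- := ext_push_mul f (conf_class om) (ext_push g (syz_class dM)).
have /= -> := napp_natural F f omd; congr qpush.
by rewrite -ext_mul_pull aE -(qladder (m := 0) ga) qpush1.
Qed.

(** * Passage to the quotient *)

Definition Psibar (q : ext_mod_proj n M W) :
  Nat (ExtF n.+1 N) (ExtF n.+1 M) := Psi (repr q).

Lemma ext_class_eq (g g' : Ext n M W) :
  (ext_class g == ext_class g') = (g - g' \in @proj_ext A C n M W).
Proof. by rewrite eqmodE -Quotient.equivE. Qed.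

(** The chosen representative differs from [g] by an element of [proj_ext], which [Psi] kills. *)
Lemma PsibarE g : Psibar (ext_class g) = Psi g.
Proof.
apply/eqP; rewrite -subr_eq0 -PsiB; apply/eqP/Psi_eq0.
by rewrite -ext_class_eq /ext_class reprK.
Qed.

Lemma ext_class_surj (q : ext_mod_proj n M W) : exists g, q = ext_class g.
Proof. by exists (repr q); rewrite /ext_class reprK. Qed.

Lemma Psibar_zmod_morphism : zmod_morphism Psibar.
Proof.
move=> q q'; have [g ->] := ext_class_surj q; have [g' ->] := ext_class_surj q'.
have -> : ext_class g - ext_class g' = ext_class (g - g').
  by rewrite /ext_class raddfB.
by rewrite !PsibarE PsiB.
Qed.

Lemma Psibar_bij : bijective Psibar.
Proof.
have injP : injective Psibar.
  move=> q q'; have [g ->] := ext_class_surj q.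
  have [g' ->] := ext_class_surj q'; rewrite !PsibarE => PsiE.
  by apply/eqP; rewrite ext_class_eq -Psi_eq0 PsiB PsiE subrr.
have surjP F : exists q, Psibar q = F.
  by have [g <-] := Psi_surj F; exists (ext_class g); apply: PsibarE.
exists (fun F => sval (cid (surjP F))) => [q|F];
  last exact: svalP (cid (surjP F)).
by apply: injP; rewrite (svalP (cid (surjP _))).
Qed.

End Psi.
End Yoneda.

Theorem theorem1p1 (A : abelian) (C : subcat A)
  (enoughP : enough_projectives C) (n : nat) (M N W : obj C)
  (delta : syzygy N n W) :
  (forall (T : obj C) (e : yext n T N),
     exists a1 : conflation T W, ladder_fixed (splice_syz a1 delta) e) /\
  exists Psi : Ext n M W -> Nat (ExtF n.+1 N) (ExtF n.+1 M),
    (forall (gamma : Ext n M W) (T : obj C) (e : yext n T N)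
        (a1 : conflation T W),
       ladder_fixed (splice_syz a1 delta) e ->
       Psi gamma T (ycl e) = ext_mul (conf_class a1) gamma) /\
    exists Psibar : {additive ext_mod_proj n M W -> Nat (ExtF n.+1 N) (ExtF n.+1 M)},
      bijective Psibar /\
      (forall gamma : Ext n M W, Psibar (ext_class gamma) = Psi gamma).
Proof.
split=> [T e|]; first exact: splice_syz_surj.
exists (Psi (M := M) delta); split=> [g T e a lad|].
  (* The ladder identifies the class of [e] with the product of [a] and [delta]; as [delta] cancels,
     any such [a] yields the same value as the one chosen in [Psi]. *)
  by rewrite -(Psi_splice delta) -ycl_splice_syz; congr (Psi delta g T);
    apply/esym/yclP/ladder_equiv.
pose addP := GRing.isZmodMorphism.Build _ _ (@Psibar _ _ n M _ _ delta)
  (Psibar_zmod_morphism enoughP delta).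
pose F : {additive _ -> _} := HB.pack (@Psibar _ _ n M _ _ delta) addP.
exists F; split; first exact: Psibar_bij.
exact: PsibarE.
Qed.
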